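(* There is an absolute constant $\gamma>0$ and a deterministic algorithm which, given integers $1<m\le n$, a number $0<\epsilon<1$, and an $n\times n$ symmetric matrix $W=(w_{ij})$ such that $$|w_{ij}-1|\ \le\ \frac{\gamma}{m-1}\quad\text{for all } i,j,$$ computes the value of $P_m(W)$ within relative error $\epsilon$ (that is, outputs a number $A$ with $|A-P_m(W)|\le \epsilon|P_m(W)|$) in $n^{O(\ln m-\ln\epsilon)}$ time, where the implicit constant in the ''$O$'' notation is absolute. One can choose $\gamma=0.06$; and if $n\ge 4m$ and $m\ge 10$, one can choose $\gamma=0.18$.
   Context: For an $n\times n$ symmetric matrix $W=(w_{ij})$ (with real or complex entries) and an integer $1<m\le n$, the partition function of cliques is $$P_m(W)=\sum_{\substack{S\subset\{1,\ldots,n\}\\ |S|=m}}\ \prod_{\substack{\{i,j\}\subset S\\ i\ne j}} w_{ij},$$ where the product is over all unordered pairs of distinct elements of $S$. Time is measured by the number of arithmetic operations. *)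

(* Defs.v *)
From HB Require Import structures.
From mathcomp Require Import all_boot all_order all_algebra.
From mathcomp Require Import complex.
From mathcomp Require Import reals exp.

Set Implicit Arguments.
Unset Strict Implicit.
Unset Printing Implicit Defensive.

Import Order.TTheory GRing.Theory Num.Theory.

Local Open Scope ring_scope.
Local Open Scope complex_scope.

(* For symmetric W, the unordered pair {i, j} of distinct elements of S is
   represented by its increasing ordering i < j. *)
Definition clique_partition (R : realType) (n m : nat) (W : 'M[R[i]]_n) : R[i] :=
  \sum_(S : {set 'I_n} | #|S| == m)
    \prod_(i in S) \prod_(j in S | (i < j)%N) W i j.

(* The model of computation is a random access machine over the complex
   numbers, programmed in a structured imperative language.  It has two
   infinite memories indexed by nat, one holding natural numbers and one holding
   complex numbers; addresses may be computed, so both can be used as arrays.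
   A program is a finite piece of syntax whose only constants are natural
   numbers: it is independent of the size and of the values of the input. *)

(* Expressions denoting natural numbers and addresses; [ISub] is truncated
   subtraction, and [IMem e] is the content of the integer cell of address
   [e]. *)
Inductive iexp : Type :=
  | ILit of nat
  | IMem of iexp
  | IAdd of iexp & iexp
  | ISub of iexp & iexp
  | IMul of iexp & iexp.

(* [TLeN a b] compares the complex numbers stored at addresses a and b, by the
   order of R[i]: z1 <= z2 iff z2 - z1 is a nonnegative real number.  On real
   numbers, this is the usual order. *)
Inductive test : Type :=
  | TLeI of iexp & iexp
  | TLeN of iexp & iexp
  | TNot of test
  | TAnd of test & test.

Inductive arith : Type := ArAdd | ArSub | ArMul | ArDiv.

Inductive cmd : Type :=
  | Skip
  | ISet of iexp & iexp                    (* ints[a] := e *)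
  | NCast of iexp & iexp                   (* nums[d] := e%:R *)
  | NCopy of iexp & iexp                   (* nums[d] := nums[a] *)
  | NOp of arith & iexp & iexp & iexp      (* nums[d] := nums[a] op nums[b] *)
  | Seq of cmd & cmd
  | If of test & cmd & cmd
  | While of test & cmd.

Record state (R : realType) : Type :=
  State { ints : nat -> nat; nums : nat -> R[i] }.

Definition upd (T : Type) (f : nat -> T) (a : nat) (v : T) : nat -> T :=
  fun k => if k == a then v else f k.

Definition set_int (R : realType) (s : state R) (a v : nat) : state R :=
  State (upd (ints s) a v) (nums s).

Definition set_num (R : realType) (s : state R) (a : nat) (v : R[i]) : state R :=
  State (ints s) (upd (nums s) a v).

Fixpoint ieval (mem : nat -> nat) (e : iexp) : nat :=
  match e with
  | ILit k => k
  | IMem e1 => mem (ieval mem e1)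
  | IAdd e1 e2 => (ieval mem e1 + ieval mem e2)%N
  | ISub e1 e2 => (ieval mem e1 - ieval mem e2)%N
  | IMul e1 e2 => (ieval mem e1 * ieval mem e2)%N
  end.

Fixpoint teval (R : realType) (s : state R) (b : test) : bool :=
  match b with
  | TLeI e1 e2 => (ieval (ints s) e1 <= ieval (ints s) e2)%N
  | TLeN a1 a2 => nums s (ieval (ints s) a1) <= nums s (ieval (ints s) a2)
  | TNot b1 => ~~ teval s b1
  | TAnd b1 b2 => teval s b1 && teval s b2
  end.

Definition arith_op (R : realType) (op : arith) (x y : R[i]) : R[i] :=
  match op with
  | ArAdd => x + y
  | ArSub => x - y
  | ArMul => x * y
  | ArDiv => x / y
  end.

(* Division by zero is not a legal step. *)
Definition arith_ok (R : realType) (op : arith) (y : R[i]) : Prop :=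
  match op with ArDiv => y != 0 | _ => True end.

(* Unit costs: besides the arithmetic operations on complex numbers, every
   integer operation, memory access, comparison and assignment is charged. *)
Fixpoint icost (e : iexp) : nat :=
  match e with
  | ILit _ => 1
  | IMem e1 => (icost e1).+1
  | IAdd e1 e2 | ISub e1 e2 | IMul e1 e2 => (icost e1 + icost e2).+1
  end.

Fixpoint tcost (b : test) : nat :=
  match b with
  | TLeI e1 e2 | TLeN e1 e2 => (icost e1 + icost e2).+1
  | TNot b1 => (tcost b1).+1
  | TAnd b1 b2 => (tcost b1 + tcost b2).+1
  end.

(* [exec c s t s']: started in state s, the program c terminates in state s'
   after t units of time. *)
Inductive exec (R : realType) : cmd -> state R -> nat -> state R -> Prop :=
  | exec_skip s : exec Skip s 0 s
  | exec_iset a e s :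
      exec (ISet a e) s (icost a + icost e).+1%N
        (set_int s (ieval (ints s) a) (ieval (ints s) e))
  | exec_ncast d e s :
      exec (NCast d e) s (icost d + icost e).+1%N
        (set_num s (ieval (ints s) d) (ieval (ints s) e)%:R)
  | exec_ncopy d a s :
      exec (NCopy d a) s (icost d + icost a).+1%N
        (set_num s (ieval (ints s) d) (nums s (ieval (ints s) a)))
  | exec_nop op d a b s :
      arith_ok op (nums s (ieval (ints s) b)) ->
      exec (NOp op d a b) s (icost d + icost a + icost b).+1%N
        (set_num s (ieval (ints s) d)
           (arith_op op (nums s (ieval (ints s) a)) (nums s (ieval (ints s) b))))
  | exec_seq c1 c2 s s1 s2 t1 t2 :
      exec c1 s t1 s1 -> exec c2 s1 t2 s2 ->
      exec (Seq c1 c2) s (t1 + t2)%N s2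
  | exec_if b c1 c2 s s1 t :
      exec (if teval s b then c1 else c2) s t s1 ->
      exec (If b c1 c2) s (tcost b + t).+1%N s1
  | exec_while_false b c s :
      ~~ teval s b -> exec (While b c) s (tcost b).+1 s
  | exec_while_true b c s s1 s2 t1 t2 :
      teval s b -> exec c s t1 s1 -> exec (While b c) s1 t2 s2 ->
      exec (While b c) s (tcost b + t1 + t2).+1%N s2.

Lemma exec_det (R : realType) (c : cmd) (s s1 s2 : state R) (t1 t2 : nat) :
  exec c s t1 s1 -> exec c s t2 s2 -> t1 = t2 /\ s1 = s2.
Proof.
move=> H; elim: H t2 s2 => {c s t1 s1}.
- by move=> s t2 s2 H; inversion H; subst.
- by move=> a e s t2 s2 H; inversion H; subst.
- by move=> d e s t2 s2 H; inversion H; subst.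
- by move=> d a s t2 s2 H; inversion H; subst.
- by move=> op d a b s _ t2 s2 H; inversion H; subst.
- move=> c1 c2 s s1 s2 t1 t2 _ IH1 _ IH2 t s' H.
  inversion H as [ | | | | | ? ? ? u1 ? ? ? E1 E2 | | | ]; subst.
  by have [? ?] := IH1 _ _ E1; subst; have [? ?] := IH2 _ _ E2; subst.
- move=> b c1 c2 s s1 t _ IH t' s' H.
  inversion H as [ | | | | | | ? ? ? ? ? ? E | | ]; subst.
  by have [? ?] := IH _ _ E; subst.
- move=> b c s /negP nb t' s' H.
  by inversion H; subst.
- move=> b c s s1 s2 t1 t2 hb _ IH1 _ IH2 t' s' H.
  inversion H as [ | | | | | | | ? ? ? nb | ? ? ? ? ? ? ? ? E1 E2]; subst.
    by rewrite hb in nb.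
  by have [? ?] := IH1 _ _ E1; subst; have [? ?] := IH2 _ _ E2; subst.
Qed.

(* Integer cells 0 and 1 contain n and m; number cell 0 contains eps, and number
   cell 1 + (i * n + j) contains W i j.  All other cells contain 0. *)
Definition input (R : realType) (n m : nat) (eps : R) (W : 'M[R[i]]_n) : state R :=
  State
    (fun k => match k with 0%N => n | 1%N => m | _ => 0%N end)
    (fun k => match k with
       | 0%N => eps%:C
       | k'.+1 =>
           match insub (k' %/ n)%N, insub (k' %% n)%N with
           | Some i, Some j => W i j
           | _, _ => 0
           end
       end).

Definition output (R : realType) (s : state R) : R[i] := nums s 0.

(* The bounds on W and on the error are inequalities in R[i], where `|z| is the
   modulus of z seen as a (real) complex number. *)
Definition approximates_cliques (R : realType) (prog : cmd) (gamma C : R)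
    (n m : nat) : Prop :=
  forall (eps : R) (W : 'M[R[i]]_n),
    0 < eps < 1 ->
    W^T = W ->
    (forall i j, `|W i j - 1| <= (gamma / (m%:R - 1))%:C) ->
    exists (t : nat) (s : state R),
      [/\ exec prog (input m eps W) t s,
          `|output s - clique_partition m W|
            <= eps%:C * `|clique_partition m W|
        & t%:R <= n%:R `^ (C * (ln m%:R - ln eps))].

(* Main.v *)
From HB Require Import structures.
Require Import Defs.
From mathcomp Require Import all_boot all_order all_algebra.
From mathcomp Require Import complex.
From mathcomp Require Import reals sequences exp.
From mathcomp Require boolp normed_module derive.
From mathcomp Require Import ring lra zify.

(** Let J be the matrix of ones and P(t) = P_m(J + t (W - J)) / 'C(n, m), a
    polynomial with P(0) = 1 whose value at 1 is wanted.

    P has no zero in the disc |t| <= 10/9.  For a set Om of mandatory vertices,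
    let P_Om be the sum of the weights of the m-sets that contain Om.  By
    downward induction on |Om|, P_Om is not zero and the numbers P_(Om + i), for
    i outside Om, are within relative distance 2/3 of each other
    ([clique_stable_all]).  Such numbers point in about the same direction, so
    that no cancellation occurs in their sum, which is a multiple of P_Om
    ([stable_children]).  This bounds the logarithmic derivative of P_(Om + j) in
    the entries of row j, and a Gronwall estimate bounds the effect of replacing
    row j by row i, which is the difference between P_(Om + j) and P_(Om + i)
    ([children_close]).

    No logarithm or exponential is computed.  With M = m ^ 2 >= deg P, let f be
    the power series P ^ (1/M).  The inverse roots of P have modulus at most
    9/10, which gives |f_j| <= (9/10) ^ j ([root_coef_le]): the truncation of f at
    degree k is within 9 (9/10) ^ k of f(1), and raising it to the power M
    multiplies the relative error by about M ([root_poly_approx]).  A degree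
    k = O(ln m - ln eps) is enough ([degree_le]).

    The coefficient of degree l of P is the sum, over the sets E of l edges, of
    the product of the w_e - 1 for e in E, times the proportion of the m-sets
    that contain all the endpoints of E.  The increasing enumerations of such
    sets are found among the numbers with l digits in base n ^ 2
    ([clique_poly_coef]), so that all the coefficients of degree at most k are
    computed in time n ^ O(k); the coefficients of f follow by the recurrence
    that M P f' = P' f gives ([root_coefS]).  The program [clique_prog] does this
    for every W, whatever the constant gamma; gamma enters only through the disc
    without zeros ([clique_prog_approximates]). *)

Set Implicit Arguments.
Unset Strict Implicit.
Unset Printing Implicit Defensive.

Import Order.TTheory GRing.Theory Num.Theory.
Local Open Scope ring_scope.
Local Open Scope complex_scope.
Local Notation re := complex.Re.
Local Notation im := complex.Im.

(** * Modulus and real inner product of complex numbers *)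

Section Modulus.
Variable R : realType.
Implicit Types x y z : R[i].

(** The norm of [R[i]] is itself a complex number; real inequalities need a real
    modulus. *)
Definition cabs z : R := Num.sqrt (re z ^+ 2 + im z ^+ 2).

Definition inner x y : R := re x * re y + im x * im y.

Lemma norm_cabs z : `|z| = (cabs z)%:C.
Proof. exact: normc_def. Qed.

Lemma cabs_ge0 z : 0 <= cabs z.
Proof. exact: sqrtr_ge0. Qed.

Lemma cabs_sqr z : cabs z ^+ 2 = inner z z.
Proof. by rewrite /inner -!expr2 sqr_sqrtr // addr_ge0 ?sqr_ge0. Qed.

Lemma cabs0 : cabs 0 = 0.
Proof. by apply/complexI; rewrite -norm_cabs normr0. Qed.

Lemma cabs1 : cabs 1 = 1.
Proof. by apply/complexI; rewrite -norm_cabs normr1. Qed.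

Lemma cabs_eq0 z : (cabs z == 0) = (z == 0).
Proof. by rewrite -(normr_eq0 z) norm_cabs; apply/eqP/eqP => [->|/complexI]. Qed.

Lemma cabs_gt0 z : (0 < cabs z) = (z != 0).
Proof. by rewrite lt_def cabs_ge0 andbT cabs_eq0. Qed.

Lemma cabsN z : cabs (- z) = cabs z.
Proof. by apply/complexI; rewrite -!norm_cabs normrN. Qed.

Lemma cabsB x y : cabs (x - y) = cabs (y - x).
Proof. by rewrite -opprB cabsN. Qed.

Lemma cabsM x y : cabs (x * y) = cabs x * cabs y.
Proof. by apply/complexI; rewrite rmorphM /= -!norm_cabs normrM. Qed.

Lemma cabsV x : cabs x^-1 = (cabs x)^-1.
Proof. by apply/complexI; rewrite fmorphV /= -!norm_cabs normfV. Qed.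

Lemma cabsX x n : cabs (x ^+ n) = cabs x ^+ n.
Proof. by apply/complexI; rewrite rmorphXn /= -!norm_cabs normrX. Qed.

Lemma cabsC (r : R) : cabs r%:C = `|r|.
Proof. by rewrite /cabs /= expr0n addr0 sqrtr_sqr. Qed.

Lemma cabs_nat n : cabs n%:R = n%:R.
Proof. by apply/complexI; rewrite -norm_cabs normr_nat rmorph_nat. Qed.

Lemma cabsD x y : cabs (x + y) <= cabs x + cabs y.
Proof. by rewrite -lecR rmorphD /= -!norm_cabs ler_normD. Qed.

Lemma cabs_sum (I : Type) (r : seq I) (P : pred I) (F : I -> R[i]) :
  cabs (\sum_(i <- r | P i) F i) <= \sum_(i <- r | P i) cabs (F i).
Proof.
rewrite -lecR -norm_cabs rmorph_sum /=.
by apply: le_trans (ler_norm_sum _ _ _) _; apply: ler_sum => i _; rewrite norm_cabs.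
Qed.

Lemma cabs_prod (I : Type) (r : seq I) (P : pred I) (F : I -> R[i]) :
  cabs (\prod_(i <- r | P i) F i) = \prod_(i <- r | P i) cabs (F i).
Proof.
by elim/big_rec2: _ => [|i a b _ <-]; rewrite ?cabs1 ?cabsM.
Qed.

Lemma innerC x y : inner x y = inner y x.
Proof. by rewrite /inner mulrC [im x * _]mulrC. Qed.

Lemma inner_suml (I : finType) (A : {set I}) (F : I -> R[i]) y :
  inner (\sum_(i in A) F i) y = \sum_(i in A) inner (F i) y.
Proof.
rewrite /inner big_split /= -!mulr_suml.
congr (_ * _ + _ * _); elim/big_rec2: _ => // i a [b c] _ <- //=; by case: (F i).
Qed.

Lemma cabs_sqrB x y : cabs (x - y) ^+ 2 = cabs x ^+ 2 - 2 * inner x y + cabs y ^+ 2.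
Proof. by rewrite !cabs_sqr /inner; case: x y => a b [c d] /=; ring. Qed.

Lemma ler_norm_inner x y : `|inner x y| <= cabs x * cabs y.
Proof.
rewrite -(@ler_pXn2r _ 2) // ?nnegrE ?mulr_ge0 ?cabs_ge0 //.
rewrite exprMn !cabs_sqr real_normK ?num_real // /inner.
case: x y => a b [c d] /=; rewrite -subr_ge0.
have -> : (a * a + b * b) * (c * c + d * d) - (a * c + b * d) ^+ 2
  = (a * d - b * c) ^+ 2 by ring.
exact: sqr_ge0.
Qed.

(** Two numbers of relative distance at most 2/3 make an angle of cosine at
    least sqrt(5)/3; the constants .74 and .86 are rational lower bounds of
    sqrt(5)/3 and of its square root. *)
Lemma inner_ge_close x y :
  cabs (x - y) <= 2 / 3 * cabs y -> 74 / 100 * (cabs x * cabs y) <= inner x y.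
Proof.
move=> h.
have : cabs (x - y) ^+ 2 <= (2 / 3 * cabs y) ^+ 2.
  by rewrite ler_pXn2r ?nnegrE ?mulr_ge0 ?cabs_ge0 //; lra.
rewrite cabs_sqrB; have := cabs_ge0 x; have := cabs_ge0 y.
move: (inner x y) (cabs x) (cabs y) => u a b b0 a0 hu.
have := sqr_ge0 (a - 74 / 100 * b); nra.
Qed.

(** Expanding the square of the modulus of the sum, every one of the pairwise
    inner products is at least .74 of the product of the moduli. *)
Lemma cabs_sum_ge (I : finType) (A : {set I}) (F : I -> R[i]) :
  (forall i j, i \in A -> j \in A -> cabs (F i - F j) <= 2 / 3 * cabs (F j)) ->
  86 / 100 * (\sum_(i in A) cabs (F i)) <= cabs (\sum_(i in A) F i).
Proof.
move=> h.
have s0 : 0 <= \sum_(i in A) cabs (F i) by apply: sumr_ge0 => i _; apply: cabs_ge0.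
rewrite -(@ler_pXn2r _ 2) // ?nnegrE ?mulr_ge0 ?cabs_ge0 //; last by lra.
apply: (@le_trans _ _ (74 / 100 * (\sum_(i in A) cabs (F i)) ^+ 2)).
  by rewrite exprMn ler_wpM2r ?exprn_ge0 //; lra.
rewrite cabs_sqr inner_suml expr2 mulr_sumr.
rewrite [leRHS](_ : _ = \sum_(i in A) \sum_(j in A) inner (F i) (F j)); last first.
  apply: eq_bigr => i _; rewrite innerC inner_suml.
  by apply: eq_bigr => j _; rewrite innerC.
rewrite mulr_sumr [leRHS]exchange_big /=; apply: ler_sum => j Aj.
rewrite mulr_suml mulr_sumr; apply: ler_sum => i Ai.
exact/inner_ge_close/h.
Qed.

End Modulus.

(** * A Gronwall estimate for complex polynomials on [0, 1] *)

Section Gronwall.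
Import normed_module.numFieldNormedType.Exports derive.
Variable R : realType.

Lemma horner_map_re (p : {poly R[i]}) (s : R) :
  (map_poly (@complex.Re R) p).[s] = re (p.[s%:C]).
Proof.
elim/poly_ind: p => [|p c IH]; first by rewrite map_poly0 // !horner0.
rewrite (_ : map_poly _ _ = map_poly (@complex.Re R) p * 'X + (re c)%:P); last first.
  apply/polyP => i; rewrite coef_map_id0 // !coefD !coefMX !coefC.
  by case: i => [|i] /=; [case: (p`_0) c => [? ?] [? ?] |rewrite coef_map_id0]; 
     rewrite ?addr0 ?add0r.
rewrite !hornerD !hornerMX !hornerC IH.
by case: (p.[_]) c => [a b] [c d] /=; ring.
Qed.

Lemma horner_map_im (p : {poly R[i]}) (s : R) :
  (map_poly (@complex.Im R) p).[s] = im (p.[s%:C]).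
Proof.
elim/poly_ind: p => [|p c IH]; first by rewrite map_poly0 // !horner0.
rewrite (_ : map_poly _ _ = map_poly (@complex.Im R) p * 'X + (im c)%:P); last first.
  apply/polyP => i; rewrite coef_map_id0 // !coefD !coefMX !coefC.
  by case: i => [|i] /=; [case: (p`_0) c => [? ?] [? ?] |rewrite coef_map_id0]; 
     rewrite ?addr0 ?add0r.
rewrite !hornerD !hornerMX !hornerC IH.
by case: (p.[_]) c => [a b] [c d] /=; ring.
Qed.

Lemma deriv_map_re (p : {poly R[i]}) :
  (map_poly (@complex.Re R) p)^`() = map_poly (@complex.Re R) p^`().
Proof.
apply/polyP => i; rewrite coef_deriv !coef_map_id0 // coef_deriv.
move: (p`_i.+1) => z; elim: i.+1 => [|k IH]; first by rewrite !mulr0n.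
by rewrite !mulrS IH; case: z (z *+ k) {IH} => [? ?] [? ?].
Qed.

Lemma deriv_map_im (p : {poly R[i]}) :
  (map_poly (@complex.Im R) p)^`() = map_poly (@complex.Im R) p^`().
Proof.
apply/polyP => i; rewrite coef_deriv !coef_map_id0 // coef_deriv.
move: (p`_i.+1) => z; elim: i.+1 => [|k IH]; first by rewrite !mulr0n.
by rewrite !mulrS IH; case: z (z *+ k) {IH} => [? ?] [? ?].
Qed.

Lemma nincr_of_is_derive (f df : R -> R) :
  (forall x : R, is_derive x (1 : R) f (df x)) -> (forall x, 0 <= x <= 1 -> df x <= 0) ->
  forall x, 0 <= x <= 1 -> f x <= f 0.
Proof.
move=> hf hdf x /andP[x0 x1].
apply: (@ler0_derive1_nincr _ f 0 1) => //.
- move=> y; rewrite in_itv /= => /andP[y0 y1].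
  by rewrite derive1E derive_val hdf // !ltW.
- by apply: derivable_within_continuous => y _; case: (hf y).
Qed.

Lemma is_derive_horner_expR (q : {poly R}) (l x : R) :
  is_derive x (1 : R) (fun s => q.[s] * expR (l * s))
    ((q^`().[x] + l * q.[x]) * expR (l * x)).
Proof.
have hE : is_derive x (1 : R) (fun s => expR (l * s)) (l * expR (l * x)).
  rewrite (_ : (fun s => _) = expR \o horner (l *: 'X)); last first.
    by apply: boolp.funext => s /=; rewrite hornerZ hornerX.
  apply: is_derive_eq; rewrite derivZ derivX !hornerE /=.
  by rewrite mulr1 mulrC.
have hq : is_derive x (1 : R) (horner q) q^`().[x] by exact: is_derive_poly.
apply: (is_derive_eq (is_deriveM hq hE)).
rewrite /GRing.scale /=. ring.
Qed.

(** Both bounds come from a monotone function: first |p(s)|^2 exp(-2Ls), which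
    gives |p(s)| <= exp(Ls) |p(0)|, and then, for every fixed u, the function
    <p(s), u> - |u| |p(0)| exp(Ls). *)
Lemma gronwall (p : {poly R[i]}) (L : R) : 0 <= L ->
  (forall s : R, 0 <= s <= 1 -> cabs p^`().[s%:C] <= L * cabs p.[s%:C]) ->
  cabs (p.[1] - p.[0]) <= (expR L - 1) * cabs p.[0].
Proof.
move=> L0 hp.
set a := map_poly (@complex.Re R) p; set c := map_poly (@complex.Im R) p.
have aE s : a.[s] = re p.[s%:C] by exact: horner_map_re.
have cE s : c.[s] = im p.[s%:C] by exact: horner_map_im.
have a'E s : a^`().[s] = re p^`().[s%:C] by rewrite deriv_map_re horner_map_re.
have c'E s : c^`().[s] = im p^`().[s%:C] by rewrite deriv_map_im horner_map_im.
have growth s : 0 <= s <= 1 -> cabs p.[s%:C] <= expR (L * s) * cabs p.[0].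
  move=> s01.
  have := @nincr_of_is_derive _ _ (is_derive_horner_expR (a ^+ 2 + c ^+ 2) (- 2 * L)).
  have NE x : (a ^+ 2 + c ^+ 2).[x] = cabs p.[x%:C] ^+ 2.
    by rewrite !hornerE aE cE cabs_sqr /inner -!expr2.
  move=> /(_ _ s s01); rewrite !NE mulr0 expR0 mulr1 => h.
  rewrite -(@ler_pXn2r _ 2) // ?nnegrE ?mulr_ge0 ?cabs_ge0 ?expR_ge0 //.
  rewrite exprMn -expRM_natl -ler_pdivrMl ?expR_gt0 // -expRN mulrC.
  rewrite (_ : - _ = - 2 * L * s); last by ring.
  apply: h => x x01; rewrite NE mulr_le0_ge0 ?expR_ge0 //.
  rewrite derivD !derivCE !hornerE /= aE cE a'E c'E.
  have h1 := ler_norm_inner p^`().[x%:C] p.[x%:C].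
  have h2 := hp _ x01; have h3 := cabs_ge0 p.[x%:C].
  have h4 : inner p^`().[x%:C] p.[x%:C] <= L * cabs p.[x%:C] ^+ 2.
    apply: le_trans (ler_norm _) (le_trans h1 _).
    by rewrite expr2 mulrA ler_wpM2r.
  by rewrite /inner in h4; lra.
set d := p.[1] - p.[0].
have [->|d0] := eqVneq d 0.
  by rewrite cabs0 mulr_ge0 ?cabs_ge0 // subr_ge0 -expR0 ler_expR.
have dgt : 0 < cabs d by rewrite cabs_gt0.
set q := re d *: a + im d *: c.
have qE x : q.[x] = inner d p.[x%:C] by rewrite !hornerE aE cE.
have q'E x : q^`().[x] = inner d p^`().[x%:C].
  by rewrite derivD !derivZ !hornerE a'E c'E.
have hd (x : R) : is_derive x (1 : R)
    (fun s => q.[s] * expR (0 * s) - (cabs d * cabs p.[0])%:P.[s] * expR (L * s))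
    ((q^`().[x] + 0 * q.[x]) * expR (0 * x) -
     ((cabs d * cabs p.[0])%:P^`().[x] + L * (cabs d * cabs p.[0])%:P.[x]) * expR (L * x)).
  by apply: is_deriveB; exact: is_derive_horner_expR.
have /(_ _ 1) := nincr_of_is_derive hd.
rewrite !mul0r !expR0 !mulr1 !hornerC !mulr0 expR0 mulr1 !qE lexx ler01 => h.
have {h} : cabs d ^+ 2 <= cabs d * ((expR L - 1) * cabs p.[0]).
  have -> : cabs d ^+ 2 = inner d p.[1] - inner d p.[0].
    rewrite cabs_sqr {2}/d /inner; case: (d) p.[1] p.[0] => ? ? [? ?] [? ?] /=; ring.
  suff: inner d p.[1] - cabs d * cabs p.[0] * expR L <= inner d p.[0] - cabs d * cabs p.[0].
    lra.
  apply: h => // x x01; rewrite !mul0r expR0 addr0 mulr1 q'E derivC !hornerC add0r.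
  rewrite subr_le0; apply: le_trans (ler_norm _) _.
  apply: le_trans (ler_norm_inner _ _) _.
  rewrite mulrCA -!mulrA ler_wpM2l ?cabs_ge0 //.
  apply: le_trans (hp _ x01) _; rewrite ler_wpM2l // mulrC.
  exact: growth.
by rewrite expr2 ler_pM2l.
Qed.

(** With L = .476, the bound on the logarithmic derivative of the sums of cliques,
    [gronwall] gives a relative distance of at most 2/3. *)
Lemma expR_le_5_3 (L : R) : L <= 476 / 1000 -> expR L <= 5 / 3.
Proof.
move=> hL.
(* exp(-L) is the fourth power of exp(-L/4) >= 1 - L/4, and .881 ^ 4 > .6. *)
have h : 881 / 1000 <= expR (- (L / 4)).
  by apply: le_trans (expR_ge1Dx _); lra.
have h4 : (881 / 1000) ^+ 4 <= expR (- (L / 4)) ^+ 4.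
  by rewrite ler_pXn2r // ?nnegrE ?expR_ge0 //; lra.
have e4 : expR (- (L / 4)) ^+ 4 = (expR L)^-1.
  by rewrite -expRM_natl -expRN; congr expR; field.
rewrite -[expR L]invrK -e4 -[leRHS]invrK lef_pV2 ?posrE; last 2 first.
- by rewrite exprn_gt0 ?expR_gt0.
- by rewrite invr_gt0; lra.
by apply: le_trans h4; rewrite invf_div; lra.
Qed.

End Gronwall.

(** * Sums of cliques with mandatory vertices *)

Section Cliques.
Variables (R : realType) (n : nat).
Local Notation C := R[i].
Implicit Types (Z : 'I_n -> 'I_n -> C) (y : 'I_n -> C) (S U V Om : {set 'I_n}).

Definition clique_weight Z S : C := \prod_(i in S) \prod_(j in S | (i < j)%N) Z i j.

Definition clique_sum (m : nat) Z V Om : C :=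
  \sum_(S : {set 'I_n} | (Om \subset S) && (S \subset V) && (#|S| == m)) clique_weight Z S.

(** The sums of the cliques that contain j, as a function of the row j alone: S
    runs over the other vertices and y gives their edges to j. *)
Definition row_sum (m : nat) Z U Om y : C :=
  \sum_(S : {set 'I_n} | (Om \subset S) && (S \subset U) && (#|S|.+1 == m))
    clique_weight Z S * \prod_(l in S) y l.

Lemma eq_clique_weight Z Z' S :
  (forall a b, a \in S -> b \in S -> Z a b = Z' a b) ->
  clique_weight Z S = clique_weight Z' S.
Proof.
by move=> h; apply: eq_bigr => a aS; apply: eq_bigr => b /andP[bS _]; exact: h.
Qed.

Lemma clique_weight_setU1 Z S x : (forall a b, Z a b = Z b a) -> x \notin S ->
  clique_weight Z (x |: S) = clique_weight Z S * \prod_(l in S) Z x l.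
Proof.
move=> sZ xS; rewrite /clique_weight big_setU1 //=.
have h a : a \in S -> \prod_(j in x |: S | (a < j)%N) Z a j
  = (if (a < x)%N then Z a x else 1) * \prod_(j in S | (a < j)%N) Z a j.
  move=> aS; rewrite big_mkcondr big_setU1 //= -big_mkcondr //=.
rewrite (eq_bigr _ h) big_split /= -big_mkcondr mulrA [RHS]mulrC; congr (_ * _).
rewrite [RHS](bigID (fun l : 'I_n => (l < x)%N)) /= mulrC; congr (_ * _).
  by apply: eq_bigr => a _; rewrite sZ.
rewrite big_mkcondr big_setU1 //= ltnn mul1r -big_mkcondr; apply: eq_bigl => a.
case aS: (a \in S) => //=; rewrite ltn_neqAle -leqNgt.
by case: eqVneq => //= /val_inj xa; rewrite xa aS in xS.
Qed.

Lemma clique_sum_row m Z U Om j : (forall a b, Z a b = Z b a) ->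
  j \notin U -> Om \subset U ->
  clique_sum m Z (j |: U) (j |: Om) = row_sum m Z U Om (Z j).
Proof.
move=> sZ jU OmU; rewrite /clique_sum /row_sum.
rewrite (reindex_onto (fun S => j |: S) (fun S => S :\ j)) /=; last first.
  by move=> S /andP[/andP[+ _] _]; rewrite subUset sub1set => /andP[jS _]; exact: setD1K.
have e S : ((j |: Om \subset j |: S) && (j |: S \subset j |: U) && (#|j |: S| == m)
   && ((j |: S) :\ j == S)) = (Om \subset S) && (S \subset U) && (#|S|.+1 == m).
  have [jS|jS] := boolP (j \in S).
    rewrite [RHS](_ : _ = false); last first.
      apply/negP => /andP[/andP[_ SU] _]; move/subsetP: SU => /(_ _ jS) h.
      by rewrite h in jU.
    apply/negP => /andP[_ /eqP h]; move: jS; rewrite -h !inE eqxx //.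
  rewrite setU1K // eqxx andbT cardsU1 jS add1n; congr (_ && _ && _).
    apply/idP/idP => h; last exact: setUS.
    apply/subsetP => x xO; move/subsetP: h => /(_ x); rewrite !inE xO orbT => /(_ isT).
    by case/orP => // /eqP xj; move/subsetP: OmU jU => /(_ _ xO); rewrite xj => ->.
  apply/idP/idP => h; last exact: setUS.
  apply/subsetP => x xO; move/subsetP: h => /(_ x); rewrite !inE xO orbT => /(_ isT).
  by case/orP => // /eqP xj; rewrite -xj xO in jS.
rewrite (eq_bigl _ _ e); apply: eq_bigr => S /andP[/andP[_ SU] _].
apply: clique_weight_setU1 => //; apply: contra jU; exact: (subsetP SU).
Qed.

Lemma clique_sum_split m Z V Om i :
  clique_sum m Z V Om = clique_sum m Z V (i |: Om) + clique_sum m Z (V :\ i) Om.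
Proof.
rewrite /clique_sum (bigID (fun S : {set 'I_n} => i \in S)) /=; congr (_ + _).
  by apply: eq_bigl => S; rewrite subUset sub1set; do !case: (_ \in _); do !case: (_ \subset _); do ?case: (_ == _).
apply: eq_bigl => S; rewrite subsetD1; do !case: (_ \in _); do !case: (_ \subset _); by do ?case: (_ == _).
Qed.

Lemma clique_sum_small m Z V Om : (#|V| < m)%N -> clique_sum m Z V Om = 0.
Proof.
move=> h; rewrite /clique_sum big_pred0 // => S.
apply/negP => /andP[/andP[_ /subset_leq_card SV] /eqP Sm]; lia.
Qed.

Lemma clique_sum_large m Z V Om : (m < #|Om|)%N -> clique_sum m Z V Om = 0.
Proof.
move=> h; rewrite /clique_sum big_pred0 // => S.
apply/negP => /andP[/andP[/subset_leq_card SV _] /eqP Sm]; lia.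
Qed.

(** Double counting of the pairs (l, S) with l in S but not in Om. *)
Lemma clique_sum_children m Z V Om :
  \sum_(l in V :\: Om) clique_sum m Z V (l |: Om)
    = (m - #|Om|)%:R * clique_sum m Z V Om.
Proof.
rewrite /clique_sum (exchange_big_dep
  (fun S : {set 'I_n} => (Om \subset S) && (S \subset V) && (#|S| == m))) /=; last first.
  by move=> l S _ /andP[/andP[+ -> ->]]; rewrite subUset => /andP[_ ->].
rewrite mulr_sumr; apply: eq_bigr => S /andP[/andP[OS SV] /eqP Sm].
rewrite sumr_const mulr_natl; congr (_ *+ _).
rewrite -Sm -cardsDS //; apply: eq_card => l.
rewrite unfold_in /= !inE subUset sub1set OS SV Sm eqxx !andbT.
by case lS: (l \in S); rewrite ?andbF // (subsetP SV) // !andbT.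
Qed.

Definition set_row Z j y a b : C :=
  if a == j then y b else if b == j then y a else Z a b.

Lemma set_row_sym Z j y : (forall a b, Z a b = Z b a) ->
  forall a b, set_row Z j y a b = set_row Z j y b a.
Proof.
move=> sZ a b; rewrite /set_row.
by case: (eqVneq a j) => [aj|aj]; case: (eqVneq b j) => [bj|bj]; rewrite ?aj ?bj /=.
Qed.

Lemma row_sum_set_row m Z U Om j y : j \notin U ->
  row_sum m (set_row Z j y) U Om (set_row Z j y j) = row_sum m Z U Om y.
Proof.
move=> jU; apply: eq_bigr => S /andP[/andP[_ SU] _].
have jS a : a \in S -> a != j by move=> /(subsetP SU) aU; apply: contraNneq jU => <-.
congr (_ * _).
  by apply: eq_clique_weight => a b /jS /negbTE aj /jS /negbTE bj; rewrite /set_row aj bj.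
by apply: eq_bigr => l /jS lj; rewrite /set_row eqxx.
Qed.

(** A logarithmic derivative in multiplied form. *)
Lemma deriv_prod_affine S (a b : 'I_n -> C) (s : C) :
  (forall l, a l + b l * s != 0) ->
  (\prod_(l in S) ((a l)%:P + b l *: 'X))^`().[s]
    = (\sum_(l in S) b l / (a l + b l * s)) * \prod_(l in S) (a l + b l * s).
Proof.
move=> nz.
pose Q (p : {poly C}) (u v : C) := p.[s] = v /\ p^`().[s] = u * v.
suff: Q (\prod_(l in S) ((a l)%:P + b l *: 'X))
  (\sum_(l in S) b l / (a l + b l * s)) (\prod_(l in S) (a l + b l * s)) by case.
elim/big_rec3: _ => [|l p u v _ [e e']]; first by rewrite /Q derivC !hornerC mul0r.
split; first by rewrite !hornerE e.
rewrite derivM derivD derivC derivZ derivX !hornerE e e' /=.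
by have := nz l => nzl; field.
Qed.

Definition segment y y' (s : R) l : C := y l + (y' l - y l) * s%:C.

(** [gronwall] along the segment from y to y': the derivative of the sum in the
    entry l is the partial sum over the sets containing l, divided by the entry. *)
Lemma row_sum_diff m Z U Om y y' (L : R) : 0 <= L ->
  (forall (s : R) l, 0 <= s <= 1 -> segment y y' s l != 0) ->
  (forall s : R, 0 <= s <= 1 ->
     \sum_(l in U) cabs ((y' l - y l) / segment y y' s l)
                     * cabs (row_sum m Z U (l |: Om) (segment y y' s))
       <= L * cabs (row_sum m Z U Om (segment y y' s))) ->
  cabs (row_sum m Z U Om y' - row_sum m Z U Om y)
    <= (expR L - 1) * cabs (row_sum m Z U Om y).
Proof.
move=> L0 nz h.
pose p : {poly C} := \sum_(S : {set 'I_n} | (Om \subset S) && (S \subset U) && (#|S|.+1 == m))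
    clique_weight Z S *: \prod_(l in S) ((y l)%:P + (y' l - y l) *: 'X).
have pE s : p.[s] = row_sum m Z U Om (fun l => y l + (y' l - y l) * s).
  rewrite horner_sum; apply: eq_bigr => S _; rewrite hornerZ horner_prod.
  by congr (_ * _); apply: eq_bigr => l _; rewrite !hornerE.
have eq1 : row_sum m Z U Om y' = p.[1].
  rewrite pE; apply: eq_bigr => S _; congr (_ * _); apply: eq_bigr => l _.
  by rewrite mulr1 addrC subrK.
have eq0 : row_sum m Z U Om y = p.[0].
  rewrite pE; apply: eq_bigr => S _; congr (_ * _); apply: eq_bigr => l _.
  by rewrite mulr0 addr0.
rewrite eq1 eq0; apply: gronwall => // s s01.
rewrite pE; apply: le_trans (h s s01).
set ys := segment y y' s.
have -> : p^`().[s%:C] = \sum_(l in U) (y' l - y l) / ys l * row_sum m Z U (l |: Om) ys.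
  rewrite raddf_sum horner_sum /row_sum.
  under [RHS]eq_bigr do rewrite mulr_sumr.
  rewrite (exchange_big_dep
    (fun S : {set 'I_n} => (Om \subset S) && (S \subset U) && (#|S|.+1 == m))) /=; last first.
    by move=> l S _ /andP[/andP[+ -> ->]]; rewrite subUset => /andP[_ ->].
  apply: eq_bigr => S /andP[/andP[OS SU] /eqP Sm].
  rewrite derivZ hornerZ deriv_prod_affine; last by move=> l; exact: nz.
  rewrite -mulr_suml mulrCA; congr (_ * _).
  apply: eq_bigl => l; rewrite subUset sub1set OS SU Sm eqxx !andbT.
  by case lS: (l \in S); rewrite ?andbF // (subsetP SU).
apply: le_trans (cabs_sum _ _ _) _.
by apply: ler_sum => l _; rewrite cabsM.
Qed.

Definition near_one (d : R) Z := forall a b, cabs (Z a b - 1) <= d.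

Definition clique_stable m Z V Om :=
  clique_sum m Z V Om != 0 /\
  forall i j, i \in V :\: Om -> j \in V :\: Om ->
    cabs (clique_sum m Z V (i |: Om) - clique_sum m Z V (j |: Om))
      <= 2 / 3 * cabs (clique_sum m Z V (j |: Om)).

(** The sum of the children is a multiple of their parent, and does not cancel. *)
Lemma stable_children m Z V Om : clique_stable m Z V Om ->
  86 / 100 * \sum_(l in V :\: Om) cabs (clique_sum m Z V (l |: Om))
    <= (m - #|Om|)%:R * cabs (clique_sum m Z V Om).
Proof.
by case=> _ h; apply: le_trans (cabs_sum_ge h) _; rewrite clique_sum_children cabsM cabs_nat.
Qed.

Section Induction.
Variables (m : nat) (d : R).
Hypotheses (d0 : 0 <= d) (d1 : d < 1).
(* An entry moves by at most 2 d along the segment between two rows, that is by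
   2 d / (1 - d) relative to its modulus, and 9/22 / .86 < .476. *)
Hypothesis hd : 2 * d * (m%:R - 1) <= 9 / 22 * (1 - d).

Lemma near_one_neq0 (z : C) : cabs (z - 1) <= d -> z != 0.
Proof.
by move=> h; apply: contraTneq h => ->; rewrite sub0r cabsN cabs1 -ltNge.
Qed.

Lemma near_one_segment (y1 y2 : C) (s : R) : 0 <= s <= 1 ->
  cabs (y1 - 1) <= d -> cabs (y2 - 1) <= d ->
  cabs (y1 + (y2 - y1) * s%:C - 1) <= d.
Proof.
move=> /andP[s0 s1] h1 h2.
have -> : y1 + (y2 - y1) * s%:C - 1 = (1 - s)%:C * (y1 - 1) + s%:C * (y2 - 1).
  rewrite rmorphB rmorph1; ring.
apply: le_trans (cabsD _ _) _; rewrite !cabsM !cabsC !ger0_norm ?subr_ge0 //.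
nra.
Qed.

Lemma near_one_ratio (y1 y2 z : C) :
  cabs (y1 - 1) <= d -> cabs (y2 - 1) <= d -> cabs (z - 1) <= d ->
  cabs ((y2 - y1) / z) <= 2 * d / (1 - d).
Proof.
have d0' := d0; have d1' := d1.
move=> h1 h2 h3.
have z1 : 1 - d <= cabs z.
  have := cabsD z (1 - z); rewrite subrKC cabs1 [cabs (1 - z)]cabsB; lra.
have h : cabs (y2 - y1) <= 2 * d.
  have -> : y2 - y1 = (y2 - 1) + (1 - y1) by ring.
  by apply: le_trans (cabsD _ _) _; rewrite [cabs (1 - _)]cabsB; lra.
rewrite cabsM cabsV ler_pdivrMr; last by lra.
apply: le_trans h _; rewrite mulrAC ler_pdivlMr; last by lra.
by rewrite ler_wpM2l //; lra.
Qed.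

(** Swapping i and j moves only the row of the new mandatory vertex: both sums
    split off the same term, indexed by the sets that contain i and j, and the
    remaining terms are values of one [row_sum] at two rows.  The term at row j
    is not larger than the whole sum, because the common term X satisfies
    2 <P_(Om + j), X> >= |X|^2, a bound inherited from the children of Om + j. *)
Lemma children_close k :
  (forall V Om Z, (forall a b, Z a b = Z b a) -> near_one d Z -> Om \subset V ->
     (#|Om| + k = m)%N -> (m <= #|V|)%N -> clique_stable m Z V Om) ->
  forall V Om Z i j, (forall a b, Z a b = Z b a) -> near_one d Z -> Om \subset V ->
    (#|Om| + k.+1 = m)%N -> (m <= #|V|)%N -> i \in V :\: Om -> j \in V :\: Om ->
    cabs (clique_sum m Z V (i |: Om) - clique_sum m Z V (j |: Om))
      <= 2 / 3 * cabs (clique_sum m Z V (j |: Om)).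
Proof.
have d0' := d0; have d1' := d1; have hd' := hd.
move=> IH V Om Z i j sZ nZ OV Ok mV; rewrite !inE => /andP[iO iV] /andP[jO jV].
have [<-|ij] := eqVneq i j; first by rewrite subrr cabs0 mulr_ge0 ?cabs_ge0 //; lra.
set U := V :\ i :\ j.
have iU : i \notin U by rewrite !inE eqxx andbF.
have jU : j \notin U by rewrite !inE eqxx.
have OU : Om \subset U by rewrite !subsetD1 OV iO jO.
have Vi : V :\ i = j |: U by rewrite setD1K // !inE eq_sym ij.
have Vj : V :\ j = i |: U.
  have -> : U = V :\ j :\ i by apply/setP => l; rewrite !inE andbCA.
  by rewrite setD1K // !inE ij.
have OjV : j |: Om \subset V by rewrite subUset sub1set jV.
have OjVi : j |: Om \subset V :\ i by rewrite Vi setUS.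
have Oj : (#|j |: Om| + k = m)%N by rewrite cardsU1 jO add1n addSnnS.
set X := clique_sum m Z V (i |: (j |: Om)).
have ej : clique_sum m Z V (j |: Om) = X + row_sum m Z U Om (Z j).
  by rewrite (clique_sum_split _ _ _ _ i) Vi clique_sum_row.
have ei : clique_sum m Z V (i |: Om) = X + row_sum m Z U Om (Z i).
  by rewrite (clique_sum_split _ _ _ _ j) Vj clique_sum_row // setUCA.
have -> : clique_sum m Z V (i |: Om) - clique_sum m Z V (j |: Om)
    = row_sum m Z U Om (Z i) - row_sum m Z U Om (Z j) by rewrite ei ej; ring.
have hQ : cabs (row_sum m Z U Om (Z j)) <= cabs (clique_sum m Z V (j |: Om)).
  have [_ hst] := IH V (j |: Om) Z sZ nZ OjV Oj mV.
  have iin : i \in V :\: (j |: Om) by rewrite !inE (negbTE ij) iO iV.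
  have -> : row_sum m Z U Om (Z j) = clique_sum m Z V (j |: Om) - X by rewrite ej; ring.
  have [k0|k0] := posnP k.
    have -> : X = 0.
      apply: clique_sum_large; rewrite cardsU1 !inE (negbTE ij) (negbTE iO).
      by rewrite -Oj k0 addn0.
    by rewrite subr0 lexx.
  rewrite -(@ler_pXn2r _ 2) // ?nnegrE ?cabs_ge0 // cabs_sqrB.
  (* |P - X| <= |P| is equivalent to this bound, which each child l satisfies
     because |X - P_l| <= |P_l|; there are at least k children. *)
  suff : cabs X ^+ 2 <= 2 * inner (clique_sum m Z V (j |: Om)) X by lra.
  have hl l : l \in V :\: (j |: Om) ->
      cabs X ^+ 2 / 2 <= inner (clique_sum m Z V (l |: (j |: Om))) X.
    move=> lin; have h := hst _ _ iin lin.
    have : cabs (X - clique_sum m Z V (l |: (j |: Om))) ^+ 2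
        <= cabs (clique_sum m Z V (l |: (j |: Om))) ^+ 2.
      rewrite ler_pXn2r ?nnegrE ?cabs_ge0 //; apply: le_trans h _.
      by have := cabs_ge0 (clique_sum m Z V (l |: (j |: Om))); lra.
    by rewrite cabs_sqrB innerC; lra.
  have : \sum_(l in V :\: (j |: Om)) cabs X ^+ 2 / 2
    <= \sum_(l in V :\: (j |: Om)) inner (clique_sum m Z V (l |: (j |: Om))) X.
    exact: ler_sum.
  rewrite sumr_const -inner_suml clique_sum_children cardsDS // -[_ / _ *+ _]mulr_natl.
  have mj : (m - #|j |: Om| = k)%N by rewrite -Oj addKn.
  rewrite mj; have -> : inner (k%:R * clique_sum m Z V (j |: Om)) X
      = k%:R * inner (clique_sum m Z V (j |: Om)) X.
    rewrite /inner -(rmorph_nat (real_complex R)).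
    by case: (X) (clique_sum _ _ _ _) => [? ?] [? ?] /=; ring.
  have kV : k%:R <= (#|V| - #|j |: Om|)%:R :> R by rewrite ler_nat -mj leq_sub2r.
  have k1 : 0 < k%:R :> R by rewrite ltr0n.
  have := sqr_ge0 (cabs X); move: (inner _ _) (cabs X ^+ 2) => a b b0 hc.
  have : k%:R * (b / 2) <= k%:R * a by apply: le_trans _ hc; rewrite ler_wpM2r //; lra.
  rewrite ler_pM2l //; lra.
(* When V has m elements, no m-set avoids i or j. *)
have [Vm|Vm] := ltnP #|V :\ i| m.
  have := clique_sum_small Z (j |: Om) Vm; rewrite Vi clique_sum_row // => Qj0.
  have : (#|V :\ j| < m)%N.
    by have := cardsD1 i V; rewrite {1}(cardsD1 j V) iV jV => /addnI ->.
  move=> /(clique_sum_small Z (i |: Om)); rewrite Vj clique_sum_row // => Qi0.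
  by rewrite Qi0 Qj0 subrr cabs0 mulr_ge0 ?cabs_ge0 //; lra.
apply: le_trans (_ : _ <= 2 / 3 * cabs (row_sum m Z U Om (Z j))) _; last first.
  by rewrite ler_wpM2l //; lra.
have near s l : 0 <= s <= 1 -> cabs (segment (Z j) (Z i) s l - 1) <= d.
  by move=> s01; apply: near_one_segment => //; exact: nZ.
apply: le_trans (row_sum_diff (L := 476 / 1000) _ _ _) _.
- lra.
- by move=> s l s01; apply: near_one_neq0; exact: near.
- move=> s s01; set ys := segment (Z j) (Z i) s.
  have nys l : cabs (ys l - 1) <= d by exact: near.
  set Z' := set_row Z j ys.
  have sZ' : forall a b, Z' a b = Z' b a by exact: set_row_sym.
  have nZ' : near_one d Z'.
    by move=> a b; rewrite /Z' /set_row; case: ifP => _ //; case: ifP.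
  have st := stable_children (IH _ _ _ sZ' nZ' OjVi Oj Vm).
  have rE Om' : Om' \subset U ->
      row_sum m Z U Om' ys = clique_sum m Z' (V :\ i) (j |: Om').
    by move=> O'U; rewrite Vi clique_sum_row // row_sum_set_row.
  have rin l : l \in Om -> row_sum m Z U (l |: Om) ys = row_sum m Z U Om ys.
    by move=> lO; rewrite (setUidPr _) ?sub1set.
  set q := cabs (row_sum m Z U Om ys).
  have q0 : 0 <= q by exact: cabs_ge0.
  (* A vertex l in Om belongs to all the sets; the others give the children of
     Om + j for the matrix Z' with row ys. *)
  have sumE : \sum_(l in U) cabs (row_sum m Z U (l |: Om) ys)
     = #|Om|%:R * q + \sum_(l in V :\ i :\: (j |: Om)) cabs (clique_sum m Z' (V :\ i) (l |: (j |: Om))).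
    rewrite (bigID (fun l => l \in Om)) /=; congr (_ + _).
      rewrite (eq_bigl (fun l => l \in Om)); last first.
        move=> l; rewrite andb_idl //; exact: (subsetP OU).
      rewrite (eq_bigr (fun=> q)); last by move=> l lO; rewrite rin.
      by rewrite sumr_const mulr_natl.
    apply: eq_big => [l|l /andP[lU lO]].
      by rewrite !inE negb_or; do 2 case: (l == _); do 2 case: (l \in _).
    by rewrite rE 1?setUCA // subUset sub1set lU.
  apply: le_trans (_ : _ <= \sum_(l in U) 2 * d / (1 - d) * cabs (row_sum m Z U (l |: Om) ys)) _.
    by apply: ler_sum => l _; rewrite ler_wpM2r ?cabs_ge0 // near_one_ratio //; exact: nZ.
  rewrite -mulr_sumr sumE.
  move: st; rewrite -rE // -/q.
  set T := \sum_(l in _) _; have -> : (m - #|j |: Om| = k)%N by rewrite -Oj addKn.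
  move=> st.
  have mE : m%:R - 1 = #|Om|%:R + k%:R :> R by rewrite -Ok addnS -natr1 natrD addrK.
  have h1 : 86 / 100 * (#|Om|%:R * q + T) <= (m%:R - 1) * q.
    rewrite mE; have : 0 <= #|Om|%:R * q :> R by rewrite mulr_ge0.
    lra.
  have h2 : 2 * d / (1 - d) * (m%:R - 1) <= 9 / 22.
    by rewrite mulrAC ler_pdivrMr //; lra.
  have D0 : 0 <= 2 * d / (1 - d) by rewrite divr_ge0 //; lra.
  have : 2 * d / (1 - d) * (86 / 100 * (#|Om|%:R * q + T)) <= 9 / 22 * q.
    apply: le_trans (ler_wpM2l D0 h1) _; rewrite mulrA ler_wpM2r //.
  by lra.
rewrite ler_wpM2r ?cabs_ge0 //.
have := @expR_le_5_3 R (476 / 1000) (lexx _); lra.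
Qed.

Lemma clique_stable_all k V Om Z :
  (forall a b, Z a b = Z b a) -> near_one d Z -> Om \subset V ->
  (#|Om| + k = m)%N -> (m <= #|V|)%N -> clique_stable m Z V Om.
Proof.
elim: k V Om Z => [|k IH] V Om Z sZ nZ OV Ok mV.
  split.
    rewrite /clique_sum (big_pred1 Om) => [|S].
      apply/prodf_neq0 => a _; apply/prodf_neq0 => b _; apply: near_one_neq0; exact: nZ.
    rewrite inE; have [->|SO] := eqVneq S Om; first by rewrite subxx OV -Ok addn0 eqxx.
    apply/negP => /andP[/andP[OS _] /eqP Sm].
    by case/eqP: SO; apply/esym/eqP; rewrite eqEcard OS; lia.
  move=> i j; rewrite !inE => /andP[iO iV] /andP[jO jV].
  rewrite !clique_sum_large; last 2 first.
  - by rewrite cardsU1 jO; lia.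
  - by rewrite cardsU1 iO; lia.
  by rewrite subrr cabs0 mulr0.
have close := children_close IH.
split; last by move=> i j; apply: close.
have hV : (#|Om| < #|V|)%N by lia.
have [l lV] : exists l, l \in V :\: Om.
  by apply/set0Pn; rewrite -card_gt0 cardsDS //; lia.
have /= h := cabs_sum_ge (fun i j hi hj => close V Om Z i j sZ nZ OV Ok mV hi hj).
apply: contraTneq isT => c0; move: h.
rewrite clique_sum_children c0 mulr0 cabs0 (bigD1 l) //=.
have : 0 < cabs (clique_sum m Z V (l |: Om)).
  rewrite cabs_gt0; move: (lV); rewrite !inE => /andP[lO lV'].
  have [] // := IH V (l |: Om) Z sZ nZ _ _ mV; first by rewrite subUset sub1set lV'.
  by rewrite cardsU1 lO; lia.
have : 0 <= \sum_(i in V :\: Om | i != l) cabs (clique_sum m Z V (i |: Om)).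
  by apply: sumr_ge0 => *; exact: cabs_ge0.
lra.
Qed.

End Induction.

End Cliques.

(** * Formal roots of polynomials *)

Section TruncatedPower.
Variable F : fieldType.
Implicit Types p q : {poly F}.

Lemma dvdXnP p k : reflect (forall j, (j < k)%N -> p`_j = 0) ('X^k %| p).
Proof.
apply: (iffP idP) => [/dvdpP[q ->] j jk|h]; first by rewrite coefMXn jk.
rewrite -(poly_take_drop k p) dvdp_add ?dvdp_mull //.
rewrite (_ : take_poly k p = 0) ?dvdp0 //; apply/polyP => j.
by rewrite coef_take_poly coef0; case: ifP => // /h.
Qed.

Lemma dvdXn_cancel p q k : p`_0 != 0 -> 'X^k %| p * q -> 'X^k %| q.
Proof.
move=> p0; rewrite Gauss_dvdpr // coprimep_expl // coprimep_sym.
by rewrite -['X]subr0 -polyC0 coprimep_XsubC /root horner_coef0.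
Qed.

(** This derivation keeps the degrees, which avoids shifts of indices. *)
Definition euler_deriv p : {poly F} := 'X * p^`().

Lemma coef_euler p j : (euler_deriv p)`_j = j%:R * p`_j.
Proof.
rewrite /euler_deriv coefXM coef_deriv; case: j => [|j] /=; first by rewrite mul0r.
by rewrite mulr_natl.
Qed.

Lemma eulerM p q : euler_deriv (p * q) = euler_deriv p * q + p * euler_deriv q.
Proof. by rewrite /euler_deriv derivM; ring. Qed.

Lemma eulerX p k : euler_deriv (p ^+ k.+1) = k.+1%:R * p ^+ k * euler_deriv p.
Proof. by rewrite /euler_deriv deriv_exp -mulr_natl; ring. Qed.

(** The recurrence for the coefficients of the series c ^ (1/M), when c 0 = 1, has
    full history; the prefix of the sequence is therefore built as a list. *)
Fixpoint root_prefix (c : nat -> F) (M j : nat) : seq F :=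
  if j is j'.+1 then
    let s := root_prefix c M j' in
    rcons s ((\sum_(i < j) (i.+1%:R / M%:R - (j - i.+1)%:R) * c i.+1 * s`_(j - i.+1))
             / j%:R)
  else [:: 1].

Definition root_coef c M j := (root_prefix c M j)`_j.

Lemma size_root_prefix c M j : size (root_prefix c M j) = j.+1.
Proof. by elim: j => //= j IH; rewrite size_rcons IH. Qed.

Lemma nth_root_prefix c M j k : (k <= j)%N -> (root_prefix c M j)`_k = root_coef c M k.
Proof.
elim: j => [|j IH]; first by case: k.
rewrite leq_eqVlt => /orP[/eqP -> //|kj].
by rewrite /= nth_rcons size_root_prefix kj; apply: IH.
Qed.

Lemma root_coef0 c M : root_coef c M 0 = 1.
Proof. by []. Qed.

Lemma root_coefS c M j : root_coef c M j.+1 =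
  (\sum_(i < j.+1) (i.+1%:R / M%:R - (j.+1 - i.+1)%:R) * c i.+1
      * root_coef c M (j.+1 - i.+1)) / j.+1%:R.
Proof.
rewrite /root_coef /= nth_rcons size_root_prefix ltnn eqxx; congr (_ / _).
apply: eq_bigr => i _; congr (_ * _); apply: nth_root_prefix.
by rewrite subSS leq_subr.
Qed.

End TruncatedPower.

Section Root.
Variable R : realType.
Local Notation C := R[i].
Implicit Types (P : {poly C}).

Definition root_poly P M K : {poly C} := \poly_(j < K.+1) root_coef (fun i => P`_i) M j.

Lemma coef_root_poly P M K j :
  (root_poly P M K)`_j = if (j <= K)%N then root_coef (fun i => P`_i) M j else 0.
Proof. by rewrite coef_poly ltnS. Qed.

(** The series f = P ^ (1/M) satisfies M P (D f) = f (D P). *)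
Lemma root_poly_ode P M K : (0 < M)%N -> P`_0 = 1 ->
  'X^(K.+1) %| M%:R * euler_deriv (root_poly P M K) * P
             - euler_deriv P * root_poly P M K.
Proof.
move=> M0 P0; apply/dvdXnP => j; rewrite ltnS => jK.
set f := root_coef (fun i => P`_i) M.
have fE i : (i <= j)%N -> (root_poly P M K)`_i = f i.
  by move=> ij; rewrite coef_root_poly (leq_trans ij jK).
rewrite coefB -mulrA -polyC_natr coefCM.
rewrite [euler_deriv (root_poly _ _ _) * P]mulrC !coefM.
case: j fE jK => [|j] fE jK.
  by rewrite !big_ord_recl !big_ord0 /= !coef_euler !mul0r mulr0 !addr0 mulr0 subr0.
rewrite [X in M%:R * X]big_ord_recl [X in _ - X]big_ord_recl /= !coef_euler subn0 P0 mul1r.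
rewrite !mul0r add0r (fE j.+1) //.
have j0 : j.+1%:R != 0 :> C by rewrite pnatr_eq0.
have M0' : M%:R != 0 :> C by rewrite pnatr_eq0 -lt0n.
rewrite {1}/f root_coefS mulrC [j.+1%:R * _]mulrC divfK // mulrDl !mulr_suml -big_split /=.
rewrite -sumrB big1 // => i _; rewrite /bump /= !coef_euler fE; last by lia.
rewrite -/f; move: (f _) => x; field; exact: M0'.
Qed.

(** F ^ M and P satisfy the same linear differential equation modulo X ^ (K+1),
    with the same initial value. *)
Lemma root_poly_exp P M K : (0 < M)%N -> P`_0 = 1 ->
  forall j, (j <= K)%N -> (root_poly P M K ^+ M)`_j = P`_j.
Proof.
move=> M0 P0.
set F := root_poly P M K; set H := F ^+ M - P.
have hH : 'X^(K.+1) %| euler_deriv H * P - euler_deriv P * H.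
  have -> : euler_deriv H * P - euler_deriv P * H =
     F ^+ M.-1 * (M%:R * euler_deriv F * P - euler_deriv P * F).
    have -> : euler_deriv H = euler_deriv (F ^+ M) - euler_deriv P.
      by rewrite /euler_deriv derivB mulrBr.
    rewrite /H; case: (M) M0 => // k _; rewrite eulerX exprS /=; ring.
  by rewrite dvdp_mull // root_poly_ode.
suff h j : (j <= K)%N -> H`_j = 0.
  by move=> j jK; apply/eqP; rewrite -subr_eq0 -coefB h.
elim/ltn_ind: j => j IH jK.
case: j IH jK => [_ _|j IH jK].
  by rewrite coefB P0 -!horner_coef0 horner_exp horner_coef0 coef_root_poly /= root_coef0 expr1n subrr.
have /(_ j.+1) := elimT (dvdXnP _ _) hH; rewrite ltnS => /(_ jK).
rewrite coefB !coefM big_ord_recr [X in _ - X]big_ord_recl /= subnn coef_euler P0 mulr1.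
rewrite coef_euler mul0r mul0r add0r !big1; last 2 first.
- by move=> i _; rewrite IH ?mulr0 // /bump /=; lia.
- by move=> i _; rewrite coef_euler IH ?mulr0 ?mul0r //; have := ltn_ord i; lia.
rewrite add0r subr0 => /eqP; rewrite mulf_eq0 pnatr_eq0 /=; exact/eqP.
Qed.

(** - D P / P is the generating series of the power sums of the inverse roots. *)
Lemma prod_linear_euler (r : seq C) K :
  'X^(K.+1) %| (\prod_(a <- r) (1 - a *: 'X))
     * (\poly_(j < K.+1) (if j == 0%N then 0 else \sum_(a <- r) a ^+ j))
     + euler_deriv (\prod_(a <- r) (1 - a *: 'X)).
Proof.
elim: r => [|a r IH].
  rewrite !big_nil /euler_deriv derivC mulr0 addr0 mul1r; apply/dvdXnP => j jK.
  by rewrite coef_poly jK big_nil; case: ifP.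
rewrite !big_cons; set P1 := \prod_(_ <- _) _ in IH *.
set S1 := \poly_(_ < _) _ in IH.
pose Sa : {poly C} := \poly_(j < K.+1) (if j == 0%N then 0 else a ^+ j).
have -> : \poly_(j < K.+1) (if j == 0%N then 0 else \sum_(b <- a :: r) b ^+ j) = Sa + S1.
  apply/polyP => j; rewrite coefD !coef_poly; case: ifP => _; last by rewrite addr0.
  by case: ifP => _; rewrite ?addr0 ?big_cons.
have ha : 'X^(K.+1) %| (1 - a *: 'X) * Sa - a *: 'X.
  apply/dvdXnP => j jK; rewrite coefB mulrBl mul1r coefB -scalerAl !coefZ coefXM coefX.
  rewrite !coef_poly jK; case: j jK => [|j] jK /=; first by rewrite !mulr0 !subr0.
  rewrite (ltn_trans _ jK) //; case: j jK => [|j] jK /=.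
    by rewrite mulr0 subr0 expr1 mulr1 subrr.
  by rewrite mulr0 exprS subrr subr0.
rewrite eulerM.
have -> : euler_deriv (1 - a *: 'X) = - (a *: 'X).
  by rewrite /euler_deriv derivB derivC derivZ derivX sub0r mulrN -scalerAr mulr1.
have -> : (1 - a *: 'X) * P1 * (Sa + S1) + (- (a *: 'X) * P1 + (1 - a *: 'X) * euler_deriv P1)
  = P1 * ((1 - a *: 'X) * Sa - a *: 'X) + (1 - a *: 'X) * (P1 * S1 + euler_deriv P1) by ring.
by rewrite dvdp_add // dvdp_mull.
Qed.

Lemma split_roots P M (rho : R) : 0 < rho -> P`_0 = 1 -> (size P <= M.+1)%N ->
  (forall t, cabs t <= rho^-1 -> P.[t] != 0) ->
  exists2 r : seq C, P = \prod_(a <- r) (1 - a *: 'X)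
    & (size r <= M)%N /\ forall a, a \in r -> cabs a <= rho.
Proof.
move=> rho0 P0 sP nz.
have [r Pr] := closed_field_poly_normal P.
have Pn0 : P != 0 by apply: contraTneq isT => e; move: P0; rewrite e coef0 => /esym/eqP; rewrite oner_eq0.
have l0 : lead_coef P != 0 by rewrite lead_coef_eq0.
have rz z : z \in r -> z != 0 /\ cabs z^-1 <= rho.
  move=> zr.
  have Pz : P.[z] = 0.
    by rewrite Pr hornerZ (rootP _) ?mulr0 // root_prod_XsubC.
  have h : rho^-1 < cabs z.
    by rewrite ltNge; apply/negP => /nz; rewrite Pz eqxx.
  have z0 : 0 < cabs z by apply: lt_trans h; rewrite invr_gt0.
  split; first by rewrite -cabs_gt0.
  by rewrite cabsV -[rho]invrK lef_pV2 ?posrE ?invr_gt0 // ltW.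
exists [seq z^-1 | z <- r]; last first.
  split.
    rewrite size_map -ltnS; apply: leq_trans sP.
    by rewrite Pr size_scale // size_prod_XsubC.
  by move=> a /mapP[z /rz[_ h] ->].
have fac : \prod_(z <- r) ('X - z%:P)
    = (\prod_(z <- r) - z) *: \prod_(z <- r) (1 - z^-1 *: 'X) :> {poly C}.
  elim: (r) rz => [|z s IH] rz; first by rewrite !big_nil scale1r.
  have [z0 _] := rz z (mem_head _ _).
  rewrite !big_cons IH; last by move=> y ys; apply: rz; rewrite inE ys orbT.
  have -> : 'X - z%:P = (- z) *: (1 - z^-1 *: 'X) :> {poly C}.
    rewrite scalerBr scalerA mulNr divff // scaleN1r opprK addrC; congr (_ + _).
    by rewrite scaleNr -mul_polyC mulr1.
  by rewrite -scalerAl -scalerAr scalerA.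
rewrite big_map Pr fac scalerA.
suff -> : lead_coef P * (\prod_(z <- r) - z) = 1 by rewrite scale1r.
have := P0; rewrite {1}Pr fac scalerA coefZ -horner_coef0 horner_prod.
rewrite (_ : \prod_(z <- r) (1 - z^-1 *: 'X).[0] = 1) ?mulr1 //.
by apply: big1 => z _; rewrite !hornerE ?mulr0 ?subr0.
Qed.

(** Comparing coefficients in M (D f) = - S f, where S collects the power sums
    of the inverse roots: M j |f_j| <= \sum_(1 <= i <= j) M rho^i rho^(j-i). *)
Lemma root_coef_le P M (rho : R) j : (0 < M)%N -> 0 < rho -> P`_0 = 1 ->
  (size P <= M.+1)%N -> (forall t, cabs t <= rho^-1 -> P.[t] != 0) ->
  cabs (root_coef (fun i => P`_i) M j) <= rho ^+ j.
Proof.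
move=> M0 rho0 P0 sP nz.
have [r Pr [sr hr]] := split_roots rho0 P0 sP nz.
set f := root_coef _ M.
elim/ltn_ind: j => -[|j] IH; first by rewrite /f root_coef0 cabs1 expr0.
pose S : {poly C} := \poly_(i < j.+2) (if i == 0%N then 0 else \sum_(a <- r) a ^+ i).
set F := root_poly P M j.+1.
have h : 'X^(j.+2) %| M%:R * euler_deriv F + S * F.
  apply: (@dvdXn_cancel _ P); first by rewrite P0 oner_eq0.
  have -> : P * (M%:R * euler_deriv F + S * F) =
     (M%:R * euler_deriv F * P - euler_deriv P * F) + F * (P * S + euler_deriv P) by ring.
  rewrite dvdp_add ?root_poly_ode // dvdp_mull // Pr; exact: prod_linear_euler.
have /(_ j.+1 (ltnSn _)) := elimT (dvdXnP _ _) h.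
have S0 : S`_0 = 0 by rewrite coef_poly.
rewrite coefD -polyC_natr coefCM coef_euler coefM big_ord_recl S0 mul0r add0r.
rewrite coef_root_poly leqnn -/f => /eqP; rewrite addr_eq0 => /eqP e.
have j0 : 0 < j.+1%:R :> R by rewrite ltr0n.
have M0' : 0 < M%:R :> R by rewrite ltr0n.
have : M%:R * (j.+1%:R * cabs (f j.+1)) <= M%:R * (j.+1%:R * rho ^+ j.+1).
  rewrite -[M%:R in leLHS](cabs_nat R) -[j.+1%:R in leLHS](cabs_nat R) -!cabsM e cabsN.
  apply: le_trans (cabs_sum _ _ _) _.
  apply: (@le_trans _ _ (\sum_(i < j.+1) M%:R * rho ^+ j.+1)); last first.
    by rewrite sumr_const card_ord -[_ *+ j.+1]mulr_natl mulrCA lexx.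
  apply: ler_sum => i _; rewrite /bump /= cabsM coef_poly.
  have [b0 bj] : (0 < bump 0 i)%N /\ (bump 0 i <= j.+1)%N by have := ltn_ord i; rewrite /bump; lia.
  move: (bump 0 i) b0 bj => b b0 bj.
  rewrite ltnS bj coef_root_poly leq_subr eqn0Ngt b0 /= -/f.
  rewrite -[X in rho ^+ X](subnKC bj) exprD mulrA.
  rewrite ler_pM ?cabs_ge0 //; last by apply: IH; lia.
  apply: le_trans (cabs_sum _ _ _) _.
  apply: (@le_trans _ _ (\sum_(a <- r) rho ^+ b)).
    rewrite big_seq [leRHS]big_seq; apply: ler_sum => a ar.
    by rewrite cabsX ler_pXn2r ?nnegrE ?cabs_ge0 ?hr // ltW.
  rewrite big_const_seq count_predT iter_addr_0 -[_ *+ size r]mulr_natl.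
  by rewrite ler_wpM2r ?exprn_ge0 ?ler_nat // ltW.
by rewrite !ler_pM2l.
Qed.

Lemma root_poly_horner1 P M K :
  (root_poly P M K).[1] = \sum_(j < K.+1) root_coef (fun i => P`_i) M j.
Proof.
rewrite horner_poly; apply: eq_bigr => j _; by rewrite expr1n mulr1.
Qed.

Lemma bernoulli (x : R) k : 0 <= x -> 1 + k%:R * x <= (1 + x) ^+ k.
Proof.
move=> x0; elim: k => [|k IH]; first by rewrite mul0r addr0 expr0.
rewrite exprS -natr1; have k0 : 0 <= k%:R :> R by [].
have := ler_wpM2l (addr_ge0 ler01 x0) IH.
have : 0 <= k%:R * x * x by rewrite !mulr_ge0.
nra.
Qed.

(** The relative error of a power. *)
Lemma perturb_exp (z w : C) (x : R) k : 0 <= x -> cabs (w - z) <= x * cabs z ->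
  cabs (w ^+ k - z ^+ k) <= ((1 + x) ^+ k - 1) * cabs z ^+ k.
Proof.
move=> x0 h.
have hw : cabs w <= (1 + x) * cabs z.
  by have := cabsD (w - z) z; rewrite subrK; lra.
elim: k => [|k IH]; first by rewrite !expr0 !subrr cabs0 mul0r.
have -> : w ^+ k.+1 - z ^+ k.+1 = w * (w ^+ k - z ^+ k) + (w - z) * z ^+ k.
  by rewrite !exprS; ring.
apply: le_trans (cabsD _ _) _; rewrite !cabsM cabsX.
have -> : ((1 + x) ^+ k.+1 - 1) * cabs z ^+ k.+1 =
  ((1 + x) * cabs z) * (((1 + x) ^+ k - 1) * cabs z ^+ k) + x * cabs z * cabs z ^+ k.
  by rewrite !exprS; ring.
by rewrite lerD // ?ler_wpM2r ?ler_pM ?exprn_ge0 ?cabs_ge0.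
Qed.

Lemma exprD1_le (x : R) k : 0 <= x -> k%:R * x <= 1 / 2 -> (1 + x) ^+ k <= 1 + 2 * k%:R * x.
Proof.
move=> x0; elim: k => [|k IH] h; first by rewrite expr0 mulr0 mul0r addr0.
have k0 : 0 <= k%:R :> R by [].
move: h; rewrite -natr1 => h.
have {IH} := IH _; rewrite exprS => IH.
have h1 : k%:R * x <= 1 / 2 by nra.
have := IH h1; move: ((1 + x) ^+ k) => y hy.
have : (1 + x) * y <= (1 + x) * (1 + 2 * k%:R * x) by rewrite ler_wpM2l //; lra.
have : k%:R * x * x <= 1 / 2 * x by rewrite ler_wpM2r.
nra.
Qed.

(** * Approximation of P(1) when P has no zero in the disc of radius 10/9 *)

Section ZeroFree.
Variables (P : {poly C}) (M : nat).
Hypotheses (M0 : (0 < M)%N) (P0 : P`_0 = 1) (sP : (size P <= M.+1)%N).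
Hypothesis nz : forall t, cabs t <= 10 / 9 -> P.[t] != 0.

Lemma root_coef_geom j : cabs (root_coef (fun i => P`_i) M j) <= (9 / 10) ^+ j.
Proof.
apply: root_coef_le => //; first by lra.
by move=> t; rewrite invf_div; exact: nz.
Qed.

Lemma root_poly_tail k d :
  cabs ((root_poly P M (k + d)).[1] - (root_poly P M k).[1])
    <= 9 * (9 / 10) ^+ k - 9 * (9 / 10) ^+ (k + d).
Proof.
elim: d => [|d IH]; first by rewrite addn0 !subrr cabs0.
rewrite addnS root_poly_horner1 big_ord_recr /= -root_poly_horner1 addrAC.
apply: le_trans (cabsD _ _) _; have := root_coef_geom (k + d).+1.
rewrite exprS; move: IH; set u := cabs _; set v := cabs _; lra.
Qed.

(** The coefficients of F_K ^ M are dominated by those of G ^ M, where G is the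
    truncated geometric series; at radius 19/18 the value of G is at most 20,
    so that the coefficients of degree above K sum to at most
    20 ^ M (18/19) ^ K. *)
Lemma root_poly_exp_tail K : (size P <= K)%N ->
  cabs ((root_poly P M K).[1] ^+ M - P.[1]) <= 20 ^+ M / (19 / 18) ^+ K.
Proof.
move=> PK; set F := root_poly P M K.
pose G : {poly R} := \poly_(j < K.+1) (9 / 10) ^+ j.
have dom k j : cabs (F ^+ k)`_j <= (G ^+ k)`_j.
  elim: k j => [|k IH] j.
    by rewrite !expr0 !coef1; case: eqP => _; rewrite ?cabs1 ?cabs0.
  rewrite !exprS !coefM; apply: le_trans (cabs_sum _ _ _) _; apply: ler_sum => i _.
  rewrite cabsM ler_pM ?cabs_ge0 // coef_root_poly coef_poly ltnS.
  by case: ifP => _; rewrite ?cabs0 ?root_coef_geom.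
have G0 j : 0 <= (G ^+ M)`_j by apply: le_trans (dom M j); exact: cabs_ge0.
set H := F ^+ M - P.
have r1 : 1 <= 19 / 18 :> R by lra.
have r0 : 0 < 19 / 18 :> R by lra.
have hH j : cabs H`_j <= (G ^+ M)`_j * (19 / 18) ^+ j / (19 / 18) ^+ K.
  have q0 : 0 < (19 / 18) ^+ K :> R by rewrite exprn_gt0.
  have [jK|jK] := leqP j K.
    rewrite coefB root_poly_exp // subrr cabs0.
    by rewrite divr_ge0 ?mulr_ge0 ?exprn_ge0 // ltW.
  rewrite coefB [P`_j]nth_default ?subr0; last exact: leq_trans PK (ltnW jK).
  rewrite ler_pdivlMr //; apply: ler_pM => //; [exact: cabs_ge0|exact: ltW|].
  by rewrite ler_weXn2l // ltnW.
have -> : F.[1] ^+ M - P.[1] = H.[1] by rewrite hornerD hornerN horner_exp.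
pose N := maxn (size H) (size (G ^+ M)).
rewrite (@horner_coef_wide _ N) ?leq_maxl //.
apply: le_trans (cabs_sum _ _ _) _.
apply: (@le_trans _ _ (\sum_(j < N) (G ^+ M)`_j * (19 / 18) ^+ j / (19 / 18) ^+ K)).
  by apply: ler_sum => j _; rewrite expr1n mulr1.
rewrite -mulr_suml -horner_coef_wide ?leq_maxr // ler_wpM2r //.
  by rewrite invr_ge0 exprn_ge0 // ltW.
rewrite horner_exp lerXn2r // ?nnegrE.
- rewrite /G horner_poly; apply: sumr_ge0 => j _.
  by rewrite mulr_ge0 ?exprn_ge0 //; lra.
- by [].
- rewrite /G horner_poly.
  have h L : \sum_(j < L) (9 / 10) ^+ j * (19 / 18) ^+ j = 20 - 20 * (19 / 20) ^+ L :> R.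
    elim: L => [|L IH]; first by rewrite big_ord0 expr0; lra.
    rewrite big_ord_recr /= IH -exprMn (_ : 9 / 10 * (19 / 18) = 19 / 20); last by field.
    by rewrite exprS; field.
  rewrite h; have : 0 <= (19 / 20) ^+ K.+1 :> R by rewrite exprn_ge0 //; lra.
  lra.
Qed.

(** A substitute for the value f(1), which would require a limit: a truncation
    beyond k whose M-th power is as close as desired to P(1). *)
Lemma root_poly_cvg k (eta : R) : 0 < eta ->
  exists d, cabs ((root_poly P M (k + d)).[1] ^+ M - P.[1]) <= eta.
Proof.
move=> e0.
pose x : R := 18 * 20 ^+ M / eta.
have x0 : 0 <= x by rewrite divr_ge0 ?mulr_ge0 ?exprn_ge0 // ltW.
exists (size P + Num.bound x)%N; apply: le_trans (root_poly_exp_tail _) _; first by lia.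
set K := (k + _)%N.
have bern : 1 + K%:R / 18 <= (19 / 18) ^+ K :> R.
  have := @bernoulli (1 / 18) K ltac:(lra).
  by rewrite (_ : 1 + 1 / 18 = 19 / 18) ?mul1r //; field.
rewrite ler_pdivrMr ?exprn_gt0 //; last by lra.
have : x <= K%:R.
  apply: le_trans (ltW (archi_boundP x0)) _; rewrite ler_nat /K; lia.
rewrite /x ler_pdivrMr // => hK.
move: bern; move: (_ ^+ K) => y hy.
have : K%:R / 18 * eta <= y * eta by rewrite ler_wpM2r ?ltW //; lra.
lra.
Qed.

Lemma horner1_ge : (1 / 10) ^+ M <= cabs P.[1].
Proof.
have rho0 : 0 < 9 / 10 :> R by lra.
have [|r -> [sr hr]] := split_roots rho0 P0 sP.
  by move=> t; rewrite invf_div; exact: nz.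
rewrite horner_prod cabs_prod.
apply: (@le_trans _ _ ((1 / 10) ^+ size r)).
  by rewrite ler_wiXn2l //; lra.
elim: r {sr} hr => [|a r IH] hr; first by rewrite big_nil expr0.
rewrite big_cons exprS ler_pM ?exprn_ge0 //; try lra; last first.
  by apply: IH => b br; apply: hr; rewrite inE br orbT.
rewrite !hornerE.
have := cabsD (1 - a) a; rewrite subrK cabs1.
by have := hr a (mem_head _ _); lra.
Qed.

(** The truncation z at a large degree has z ^ M close to P(1); as |P(1)| is at
    least (1/10) ^ M, this gives |z| >= 1/20, so that the distance 9 (9/10) ^ k
    from z to the truncation w at degree k is a relative error of
    180 (9/10) ^ k. *)
Theorem root_poly_approx k (eps : R) : 0 < eps < 1 ->
  1440 * M%:R * (9 / 10) ^+ k <= eps ->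
  cabs ((root_poly P M k).[1] ^+ M - P.[1]) <= eps * cabs P.[1].
Proof.
move=> /andP[e0 e1] hk.
set A := cabs P.[1].
have hA : (1 / 10) ^+ M <= A by exact: horner1_ge.
have A0 : 0 < A by apply: lt_le_trans hA; rewrite exprn_gt0 //; lra.
have [d] := @root_poly_cvg k (eps / 2 * A) (mulr_gt0 (divr_gt0 e0 (ltr0Sn _ _)) A0).
set z := (root_poly P M (k + d)).[1]; set w := (root_poly P M k).[1] => hz.
have wz : cabs (w - z) <= 9 * (9 / 10) ^+ k.
  rewrite cabsB; apply: le_trans (root_poly_tail _ _) _.
  have : 0 <= (9 / 10) ^+ (k + d) :> R by rewrite exprn_ge0 //; lra.
  by lra.
have zM1 : cabs z ^+ M <= (1 + eps / 2) * A.
  have := cabsD (z ^+ M - P.[1]) P.[1]; rewrite subrK cabsX -/A; lra.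
have zM2 : A / 2 <= cabs z ^+ M.
  have := cabsD (P.[1] - z ^+ M) (z ^+ M); rewrite subrK cabsX cabsB -/A.
  have : eps / 2 * A <= 1 / 2 * A by rewrite ler_wpM2r ?ltW //; lra.
  lra.
have z20 : 1 / 20 <= cabs z.
  rewrite -(@ler_pXn2r _ M) ?nnegrE ?cabs_ge0 //; last by lra.
  apply: le_trans zM2; rewrite (_ : 1 / 20 = 1 / 10 * (1 / 2)); last by field.
  rewrite exprMn; apply: ler_pM => //; try by rewrite exprn_ge0 //; lra.
  by rewrite mul1r -[leRHS]expr1 ler_wiXn2l //; lra.
pose x : R := 180 * (9 / 10) ^+ k.
have p0 : 0 <= (9 / 10) ^+ k :> R by rewrite exprn_ge0 //; lra.
have x0 : 0 <= x by rewrite mulr_ge0.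
have wzx : cabs (w - z) <= x * cabs z.
  apply: le_trans wz _; rewrite /x.
  have : (9 / 10) ^+ k * (1 / 20) <= (9 / 10) ^+ k * cabs z by rewrite ler_wpM2l.
  lra.
have hx : M%:R * x <= eps / 8 by rewrite /x; lra.
have hx2 : M%:R * x <= 1 / 2 by lra.
have h1 := perturb_exp M x0 wzx.
have h2 := exprD1_le x0 hx2.
have h3 : ((1 + x) ^+ M - 1) * cabs z ^+ M <= (eps / 4) * ((1 + eps / 2) * A).
  apply: ler_pM => //; last by lra.
    by rewrite subr_ge0 exprn_ege1 // lerDl.
  by rewrite exprn_ge0 // cabs_ge0.
have -> : w ^+ M - P.[1] = (w ^+ M - z ^+ M) + (z ^+ M - P.[1]) by ring.
apply: le_trans (cabsD _ _) _.
have h4 : eps / 4 * ((1 + eps / 2) * A) <= eps / 2 * A.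
  rewrite mulrA ler_wpM2r ?ltW //; nra.
lra.
Qed.

End ZeroFree.

End Root.

(** * Coefficients of the clique polynomial *)

Section BigDigits.
Variables (T : Type) (idx : T) (op : Monoid.com_law idx).

Lemma big_digits (b N : nat) (F : nat -> T) :
  \big[op/idx]_(0 <= x < N * b) F x
    = \big[op/idx]_(0 <= q < N) \big[op/idx]_(0 <= e < b) F (q * b + e)%N.
Proof.
rewrite big_nat_mul; apply: eq_bigr => q _.
rewrite -{1}[(q * b)%N]addn0 mulSn addnC big_addn addnK; apply: eq_bigr => e _.
by rewrite addnC.
Qed.

End BigDigits.

(** The coefficients are elementary symmetric functions of the g e; the sum is
    sorted by the least index e of the monomials. *)
Lemma coef_prod_increasing (F : fieldType) (g : nat -> F) (Q : pred nat) B p l :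
  (\prod_(p <= e < B | Q e) (1 + g e *: 'X))`_l.+1
   = \sum_(p <= e < B | Q e) g e * (\prod_(e.+1 <= e' < B | Q e') (1 + g e' *: 'X))`_l.
Proof.
have [k] := ubnP (B - p); elim: k p => // k IH p Bk.
have [Bp|pB] := leqP B p; first by rewrite !big_geq // coefC.
rewrite (@big_ltn_cond _ _ _ p) // [RHS]big_ltn_cond //; have {}IH := IH p.+1.
case: ifP => Qp; last by apply: IH; lia.
rewrite mulrDl mul1r coefD IH; last by lia.
by rewrite addrC -scalerAl coefZ coefXM.
Qed.

Section Coefficients.
Variables (R : realType) (n' : nat).
Let n := n'.+1.
Variables (m : nat) (W : 'M[R[i]]_n).
Local Notation C := R[i].
Implicit Types U S : {set 'I_n}.

Definition supersets U : {set {set 'I_n}} := [set S : {set 'I_n} | (U \subset S) && (#|S| == m)].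

Lemma card_supersets U : (#|U| <= m)%N -> #|supersets U| = 'C(n - #|U|, m - #|U|).
Proof.
move=> Um; have -> : (n - #|U| = #|~: U|)%N by rewrite [RHS]cardsCs setCK card_ord.
rewrite -cards_draws -(card_in_imset (f := fun S => S :|: U)); last first.
  move=> S S'; rewrite !inE => /andP[h _] /andP[h' _] /(congr1 (fun S => S :\: U)).
  rewrite !setDUl setDv !setU0 !setDE.
  by rewrite (setIidPl h) (setIidPl h').
apply: eq_card => S; rewrite inE; apply/idP/imsetP => [/andP[US /eqP Sm]|[S' + ->]].
  exists (S :\: U); last first.
    apply/setP => x; rewrite !inE; case xU: (x \in U); last by rewrite orbF.
    by rewrite orbT (subsetP US).
  by rewrite inE subsetDr cardsDS // Sm eqxx.
rewrite inE => /andP[h /eqP c]; rewrite subsetUr cardsU c.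
have -> : S' :&: U = set0 by apply/eqP; rewrite setI_eq0 disjoints_subset.
by rewrite cards0 subn0 subnK // eqxx.
Qed.

(** The proportion, among the m-sets that contain U, of those that contain a. *)
Definition touch_weight U (a : 'I_n) : C :=
  if a \in U then 1 else (m - #|U|)%:R / (n - #|U|)%:R.

Lemma card_touch U a :
  #|supersets U|%:R * touch_weight U a = #|supersets (a |: U)|%:R.
Proof.
rewrite /touch_weight; case: ifP => aU.
  by rewrite mulr1 (setUidPr _) // sub1set.
have Un : (#|U| < n)%N.
  have := max_card (a |: U); by rewrite cardsU1 aU card_ord.
have n0 : (n - #|U|)%:R != 0 :> C by rewrite pnatr_eq0; lia.
have [mU|Um] := leqP m #|U|.
  have -> : (m - #|U| = 0)%N by lia.
  rewrite mul0r mulr0 (_ : supersets _ = set0) ?cards0 //.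
  apply/setP => S; rewrite !inE; apply/negP => /andP[/subset_leq_card h /eqP c].
  by move: h; rewrite c cardsU1 aU; lia.
apply: (mulIf n0); rewrite -mulrA divfK // -!natrM; congr _%:R.
rewrite !card_supersets ?cardsU1 ?aU //=; last exact: ltnW.
move: Un Um; move: #|U| => u Un Um.
have := mul_bin_diag (n - u) (m - u).-1; rewrite !prednK ?subn_gt0 //.
by move=> e; rewrite add1n !subnS mulnC -e mulnC.
Qed.

Definition touch2 U (a b : 'I_n) := b |: (a |: U).

(** An edge is coded by a number below n ^ 2; codes of pairs that are not
    increasing have weight 0. *)
Definition edge_fst (e : nat) : 'I_n := inord (e %/ n).
Definition edge_snd (e : nat) : 'I_n := inord (e %% n).

Definition step_weight (p : nat) U (e : nat) : C :=
  (if (p <= e)%N && (edge_fst e < edge_snd e)%N then W (edge_fst e) (edge_snd e) - 1 else 0)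
    * touch_weight U (edge_fst e) * touch_weight (edge_fst e |: U) (edge_snd e).

(** The digits of y in base n ^ 2, from the lowest, are l edges which have to be
    increasing and to start at p at least; U collects their endpoints. *)
Fixpoint word_weight (l y p : nat) U : C :=
  if l is l'.+1 then
    let e := (y %% (n * n))%N in
    step_weight p U e * word_weight l' (y %/ (n * n)) e.+1 (touch2 U (edge_fst e) (edge_snd e))
  else 1.

Definition word_sum l p U : C := \sum_(0 <= x < (n * n) ^ l) word_weight l x p U.

Definition edges_in S (e : nat) : bool :=
  [&& edge_fst e \in S, edge_snd e \in S & (edge_fst e < edge_snd e)%N].

Definition edge_poly (p : nat) S : {poly C} :=
  \prod_(p <= e < n * n | edges_in S e)
     (1 + (W (edge_fst e) (edge_snd e) - 1) *: 'X).

Lemma word_sumS l p U : word_sum l.+1 p U =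
  \sum_(0 <= e < n * n) step_weight p U e
     * word_sum l e.+1 (touch2 U (edge_fst e) (edge_snd e)).
Proof.
rewrite /word_sum expnSr big_digits exchange_big_nat /=.
rewrite big_nat [RHS]big_nat; apply: eq_bigr => e /andP[_ eB].
rewrite mulr_sumr; apply: eq_bigr => q _ /=.
have B0 : (0 < n * n)%N by rewrite muln_gt0.
by rewrite divnMDl // divn_small // addn0 modnMDl modn_small.
Qed.

Lemma coef_edge_poly0 p S : (edge_poly p S)`_0 = 1.
Proof.
rewrite -horner_coef0 horner_prod; apply: big1 => e _.
by rewrite hornerD hornerC hornerZ hornerX mulr0 addr0.
Qed.

(** By induction on the length, splitting off the smallest edge.  In this form,
    multiplied by the number of supersets, the identity also holds when U has
    more than m elements. *)
Lemma word_sum_coef l p U :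
  #|supersets U|%:R * word_sum l p U = \sum_(S in supersets U) (edge_poly p S)`_l.
Proof.
elim: l p U => [|l IH] p U.
  rewrite /word_sum expn0 big_nat1 /= mulr1.
  under eq_bigr do rewrite coef_edge_poly0.
  by rewrite sumr_const.
rewrite word_sumS mulr_sumr.
under [RHS]eq_bigr do rewrite coef_prod_increasing.
have e1 e : #|supersets U|%:R * (step_weight p U e
     * word_sum l e.+1 (touch2 U (edge_fst e) (edge_snd e)))
  = if (p <= e)%N && (edge_fst e < edge_snd e)%N then
     (W (edge_fst e) (edge_snd e) - 1) *
       \sum_(S in supersets (touch2 U (edge_fst e) (edge_snd e))) (edge_poly e.+1 S)`_l
    else 0.
  rewrite /step_weight; case: ifP => _; last by rewrite !mul0r mulr0.
  by rewrite -IH /touch2 -2!card_touch; ring.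
rewrite (eq_bigr _ (fun e _ => e1 e)) {e1}.
under [RHS]eq_bigr do rewrite (@big_nat_widenl _ _ _ p 0) // big_mkcond /=.
rewrite exchange_big /=; apply: eq_bigr => e _.
case: ifP => [/andP[pe ab]|pab]; last first.
  rewrite big1 // => S _; rewrite /edges_in.
  by case: (p <= e)%N pab => /= [->|_]; rewrite ?andbF.
rewrite mulr_sumr big_mkcond [RHS]big_mkcond; apply: eq_bigr => S _.
rewrite /touch2 /edges_in !inE !subUset !sub1set ab pe !andbT.
by case: (_ \in S); case: (_ \in S); case: (U \subset S); case: (_ == m).
Qed.

(** The polynomial P of the introduction. *)
Definition clique_poly : {poly C} :=
  ('C(n, m)%:R)^-1 *: \sum_(S : {set 'I_n} | #|S| == m) edge_poly 0 S.

Lemma clique_poly_coef l : (m <= n)%N -> clique_poly`_l = word_sum l 0 set0.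
Proof.
move=> mn; have := word_sum_coef l 0 set0.
rewrite card_supersets cards0 // !subn0 coefZ => h.
have c0 : 'C(n, m)%:R != 0 :> C by rewrite pnatr_eq0 -lt0n bin_gt0.
apply: (mulfI c0); rewrite h mulrA mulfV // mul1r coef_sum.
by apply: eq_bigl => S; rewrite inE sub0set.
Qed.

Lemma prod_edges (T : comNzRingType) (F : 'I_n -> 'I_n -> T) S :
  \prod_(0 <= e < n * n | edges_in S e) F (edge_fst e) (edge_snd e)
    = \prod_(i in S) \prod_(j in S | (i < j)%N) F i j.
Proof.
rewrite big_mkcond big_digits big_mkord [RHS]big_mkcond; apply: eq_bigr => a _.
rewrite big_mkord.
have fE (b : 'I_n) : edge_fst (a * n + b)%N = a.
  by rewrite /edge_fst divnMDl // divn_small // addn0 inord_val.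
have sE (b : 'I_n) : edge_snd (a * n + b)%N = b.
  by rewrite /edge_snd modnMDl modn_small // inord_val.
rewrite (eq_bigr (fun b : 'I_n => if [&& a \in S, b \in S & (a < b)%N] then F a b else 1)); last first.
  by move=> b _; rewrite /edges_in fE sE.
by case: (a \in S) => /=; rewrite -?big_mkcond // big1.
Qed.

Lemma size_edge_poly S : #|S| = m -> (size (edge_poly 0 S) <= (m * m).+1)%N.
Proof.
move=> Sm; rewrite /edge_poly (prod_edges (fun a b => 1 + (W a b - 1) *: 'X)).
have bound (A : {set 'I_n}) (Q : pred 'I_n) (G : 'I_n -> {poly C}) d :
    (forall i, Q i -> i \in A) -> (forall i, (size (G i) <= d.+1)%N) ->
    (size (\prod_(i | Q i) G i)%R <= (#|A| * d).+1)%N.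
  move=> QA h; apply: (@leq_trans (\sum_(i | Q i) d).+1); last first.
    by rewrite sum_nat_const ltnS leq_mul2r subset_leq_card ?orbT //; exact/subsetP.
  elim/big_rec2: _ => [|i y p _ IH]; first by rewrite size_polyC oner_eq0.
  apply: leq_trans (size_polyMleq _ _) _.
  by rewrite -subn1 leq_subLR add1n -addnS -addSn leq_add.
rewrite -[in (m * m)%N]Sm; apply: (bound S) => // i.
rewrite -[X in (_ <= X.+1)%N]muln1; apply: (bound S) => [j /andP[]//|j].
apply: leq_trans (size_polyD _ _) _; rewrite geq_max size_polyC oner_eq0 /=.
by apply: leq_trans (size_scale_leq _ _) _; rewrite size_polyX.
Qed.

Lemma size_clique_poly : (size clique_poly <= (m * m).+1)%N.
Proof.
apply: leq_trans (size_scale_leq _ _) _.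
elim/big_ind: _ => [|p q hp hq|S /eqP Sm]; first by rewrite size_poly0.
  by apply: leq_trans (size_polyD _ _) _; rewrite geq_max hp.
exact: size_edge_poly.
Qed.

Lemma horner_clique_poly t : clique_poly.[t] =
  ('C(n, m)%:R)^-1 * clique_partition m (\matrix_(i, j) (1 + t * (W i j - 1))).
Proof.
rewrite hornerZ horner_sum; congr (_ * _); apply: eq_bigr => S _.
rewrite horner_prod -prod_edges; apply: eq_bigr => e _.
by rewrite !hornerE mxE mulrC.
Qed.

End Coefficients.

Lemma clique_partition_neq0 (R : realType) (n m : nat) (d : R) (Z : 'M[R[i]]_n) :
  (0 < m <= n)%N -> 0 <= d -> d < 1 -> 2 * d * (m%:R - 1) <= 9 / 22 * (1 - d) ->
  Z^T = Z -> (forall i j, cabs (Z i j - 1) <= d) -> clique_partition m Z != 0.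
Proof.
move=> /andP[m0 mn] d0 d1 hd sZ nZ.
have sZ' a b : Z a b = Z b a by rewrite -{1}sZ mxE.
have [] := @clique_stable_all R n m d d0 d1 hd m setT set0 (fun a b => Z a b) sZ' nZ.
- exact: sub0set.
- by rewrite cards0.
- by rewrite cardsT card_ord.
move=> + _; congr (_ != 0); apply: eq_bigl => S.
by rewrite sub0set subsetT.
Qed.

Theorem clique_root_approx (R : realType) (n' m k : nat) (d eps : R) (W : 'M[R[i]]_n'.+1) :
  (0 < m <= n'.+1)%N -> 0 <= d -> 10 / 9 * d < 1 ->
  2 * (10 / 9 * d) * (m%:R - 1) <= 9 / 22 * (1 - 10 / 9 * d) ->
  W^T = W -> (forall i j, cabs (W i j - 1) <= d) ->
  0 < eps < 1 -> 1440 * (m * m)%:R * (9 / 10) ^+ k <= eps ->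
  cabs ('C(n'.+1, m)%:R * (\sum_(j < k.+1) root_coef (fun l => word_sum m W l 0 set0) (m * m) j) ^+ (m * m)
     - clique_partition m W) <= eps * cabs (clique_partition m W).
Proof.
move=> m0n d0 d1 hd sW nW e01 hk; have /andP[m0 mn] := m0n.
have c0 : 'C(n'.+1, m)%:R != 0 :> R[i] by rewrite pnatr_eq0 -lt0n bin_gt0.
have P0 : (clique_poly m W)`_0 = 1.
  by rewrite clique_poly_coef // /word_sum expn0 big_nat1.
have P1 : clique_partition m W = 'C(n'.+1, m)%:R * (clique_poly m W).[1].
  rewrite horner_clique_poly mulVKf //; congr clique_partition.
  by apply/matrixP => i j; rewrite mxE mul1r subrKC.
have nz t : cabs t <= 10 / 9 -> (clique_poly m W).[t] != 0.
  move=> ht; rewrite horner_clique_poly mulf_neq0 ?invr_eq0 //.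
  apply: (clique_partition_neq0 m0n _ d1 hd) => //.
  - by rewrite mulr_ge0 //; lra.
  - by apply/matrixP => i j; rewrite !mxE -[in LHS]sW mxE.
  - by move=> i j; rewrite mxE addrAC subrr add0r cabsM ler_pM ?cabs_ge0.
have mm0 : (0 < m * m)%N by rewrite muln_gt0 m0.
have := root_poly_approx mm0 P0 (size_clique_poly m W) nz e01 hk.
have -> : (root_poly (clique_poly m W) (m * m) k).[1]
    = \sum_(j < k.+1) root_coef (fun l => word_sum m W l 0 set0) (m * m) j.
  rewrite root_poly_horner1; apply: eq_bigr => j _.
  rewrite (_ : (fun i => _) = fun l => word_sum m W l 0 set0) //.
  by apply: boolp.funext => l; rewrite clique_poly_coef.
move=> h; rewrite P1 -mulrBr !cabsM mulrCA ler_wpM2l ?cabs_ge0 //.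
Qed.

(** * Total correctness of programs with time bounds *)

Section Hoare.
Variable R : realType.
Implicit Types (s : state R) (c : cmd) (Q : state R -> Prop).

Definition run c s (T : nat) Q : Prop :=
  exists t s', [/\ exec c s t s', (t <= T)%N & Q s'].

Lemma run_le c s T T' Q : (T <= T')%N -> run c s T Q -> run c s T' Q.
Proof. by move=> h [t [s' [e tT q]]]; exists t, s'; split=> //; exact: leq_trans h. Qed.

Lemma run_post c s T Q Q' : (forall s', Q s' -> Q' s') -> run c s T Q -> run c s T Q'.
Proof. by move=> h [t [s' [e tT q]]]; exists t, s'; split=> //; exact: h. Qed.

Lemma run_seq c1 c2 s T1 T2 Q :
  run c1 s T1 (fun s1 => run c2 s1 T2 Q) -> run (Seq c1 c2) s (T1 + T2) Q.
Proof.
move=> [t1 [s1 [e1 h1 [t2 [s2 [e2 h2 q]]]]]].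
by exists (t1 + t2)%N, s2; split=> //; [exact: exec_seq e1 e2 | exact: leq_add].
Qed.

Lemma run_bind c1 c2 s T1 T2 Q1 Q :
  run c1 s T1 Q1 -> (forall s1, Q1 s1 -> run c2 s1 T2 Q) -> run (Seq c1 c2) s (T1 + T2) Q.
Proof. by move=> h1 h2; apply: run_seq; apply: run_post h1. Qed.

Lemma run_if b c1 c2 s T Q :
  (if teval s b then run c1 s T Q else run c2 s T Q) ->
  run (If b c1 c2) s (tcost b + T).+1 Q.
Proof.
move=> h; have {h} [t [s' [e tT q]]] : run (if teval s b then c1 else c2) s T Q.
  by case: ifP h.
by exists (tcost b + t).+1, s'; split; [exact: exec_if | lia | ].
Qed.

(** Every loop of the program runs a number N of times that is known beforehand. *)
Lemma run_while b c s N T (I : nat -> state R -> Prop) :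
  I 0%N s ->
  (forall j s', (j < N)%N -> I j s' -> teval s' b /\ run c s' T (I j.+1)) ->
  (forall s', I N s' -> ~~ teval s' b) ->
  run (While b c) s (N * (tcost b + T).+1 + (tcost b).+1) (I N).
Proof.
move=> I0 step stop.
suff h k j s' : (j + k = N)%N -> I j s' ->
    run (While b c) s' (k * (tcost b + T).+1 + (tcost b).+1) (I N).
  exact: (h N 0%N).
elim: k j s' => [|k IH] j s' jk Ij.
  rewrite addn0 in jk; subst j; exists (tcost b).+1, s'; split=> //.
  exact/exec_while_false/stop.
have [tb [t1 [s1 [e1 h1 I1]]]] := step j s' ltac:(lia) Ij.
have [t2 [s2 [e2 h2 I2]]] := IH j.+1 s1 ltac:(lia) I1.
exists (tcost b + t1 + t2).+1, s2; split=> //; first exact: exec_while_true e1 e2.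
by rewrite mulSn; lia.
Qed.

(** Commands without tests and loops are run by evaluation. *)
Fixpoint straight c : bool :=
  match c with
  | Seq c1 c2 => straight c1 && straight c2
  | If _ _ _ | While _ _ => false
  | _ => true
  end.

Fixpoint sem c s : state R :=
  match c with
  | ISet a e => set_int s (ieval (ints s) a) (ieval (ints s) e)
  | NCast d e => set_num s (ieval (ints s) d) (ieval (ints s) e)%:R
  | NCopy d a => set_num s (ieval (ints s) d) (nums s (ieval (ints s) a))
  | NOp op d a b => set_num s (ieval (ints s) d)
      (arith_op op (nums s (ieval (ints s) a)) (nums s (ieval (ints s) b)))
  | Seq c1 c2 => sem c2 (sem c1 s)
  | _ => s
  end.

Fixpoint safe c s : Prop :=
  match c with
  | NOp op _ _ b => arith_ok op (nums s (ieval (ints s) b))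
  | Seq c1 c2 => safe c1 s /\ safe c2 (sem c1 s)
  | _ => True
  end.

Fixpoint cost c : nat :=
  match c with
  | ISet a b | NCast a b | NCopy a b => (icost a + icost b).+1
  | NOp _ d a b => (icost d + icost a + icost b).+1
  | Seq c1 c2 => cost c1 + cost c2
  | _ => 0
  end.

Lemma run_straight c s Q : straight c -> safe c s -> Q (sem c s) -> run c s (cost c) Q.
Proof.
move=> st ok q; exists (cost c), (sem c s); split=> // {q}.
elim: c s st ok => //=; try by move=> *; constructor.
move=> c1 IH1 c2 IH2 s /andP[st1 st2] [ok1 ok2].
by apply: exec_seq; [exact: IH1 | exact: IH2].
Qed.

Lemma run_straight_seq c c' s T Q : straight c -> safe c s ->
  run c' (sem c s) T Q -> run (Seq c c') s (cost c + T) Q.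
Proof. by move=> st ok h; apply: run_seq; exact: run_straight. Qed.

End Hoare.

(** * The program *)

(** Integer cells: 0 holds n, 1 holds m, 2 holds n ^ 2, 3 holds the address n ^ 2 + 1
    of the first number cell after the input, 4 holds the degree k, and the cells
    5 to 15 are counters and temporaries; an inner loop only writes cells of
    larger index than those of the loops around it.  The cells from [marks] on are
    the characteristic function of the set of endpoints, and 10 its cardinal.

    Number cells, relative to the address in cell 3: 0 and 1 are temporaries, 2 is
    the weight of the current word, 3 an accumulator, 4 the sum of the f_j, and 5
    the result; the coefficients of P are in the cells 10 + 2 l, and those of f
    in the cells 11 + 2 j. *)

Local Notation "c1 ;; c2" := (Seq c1 c2) (at level 90, right associativity).

Definition reg (k : nat) : iexp := IMem (ILit k).
Definition marks : nat := 40.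
Definition mark (e : iexp) : iexp := IAdd (ILit marks) e.
Definition num (k : nat) : iexp := IAdd (reg 3) (ILit k).
Definition coef_cell (e : iexp) : iexp := IAdd (reg 3) (IAdd (ILit 10) (IMul (ILit 2) e)).
Definition root_cell (e : iexp) : iexp := IAdd (reg 3) (IAdd (ILit 11) (IMul (ILit 2) e)).
Definition iset (k : nat) (e : iexp) : cmd := ISet (ILit k) e.
Definition incr (k : nat) : cmd := iset k (IAdd (reg k) (ILit 1)).
Definition lt_test (a b : iexp) : test := TLeI (IAdd a (ILit 1)) b.

(** Division by repeated subtraction, in time linear in the dividend; the
    dividends are less than n ^ (2 k). *)
Definition divmod (q r d : nat) : cmd :=
  iset q (ILit 0) ;;
  While (TLeI (reg d) (reg r)) (iset r (ISub (reg r) (reg d)) ;; incr q).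

(** Multiplies the weight by [touch_weight] and adds the vertex in cell u to the
    marked set. *)
Definition touch (u : nat) : cmd :=
  If (TLeI (IMem (mark (reg u))) (ILit 0))
    (NCast (num 0) (ISub (reg 1) (reg 10)) ;;
     NCast (num 1) (ISub (reg 0) (reg 10)) ;;
     NOp ArDiv (num 0) (num 0) (num 1) ;;
     NOp ArMul (num 2) (num 2) (num 0) ;;
     incr 10 ;;
     ISet (mark (reg u)) (ILit 1))
    Skip.

Definition clear_marks : cmd :=
  iset 14 (ILit 0) ;;
  While (lt_test (reg 14) (reg 0)) (ISet (mark (reg 14)) (ILit 0) ;; incr 14).

(** One digit of the word: cell 8 holds the digits that remain and cell 9 the
    least admissible edge. *)
Definition word_step : cmd :=
  iset 13 (reg 8) ;;
  divmod 12 13 2 ;;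
  (iset 8 (reg 12) ;; iset 15 (reg 13)) ;;
  divmod 14 15 0 ;;
  If (TAnd (TLeI (reg 9) (reg 13)) (lt_test (reg 14) (reg 15)))
    (NCast (num 0) (ILit 1) ;;
     NOp ArSub (num 1) (IAdd (reg 13) (ILit 1)) (num 0) ;;
     NOp ArMul (num 2) (num 2) (num 1))
    (NCast (num 2) (ILit 0)) ;;
  touch 14 ;;
  touch 15 ;;
  (iset 9 (IAdd (reg 13) (ILit 1)) ;; incr 11).

Definition word_prog : cmd :=
  clear_marks ;;
  (iset 8 (reg 7) ;; iset 9 (ILit 0) ;; iset 10 (ILit 0) ;; iset 11 (ILit 0) ;;
   NCast (num 2) (ILit 1)) ;;
  While (lt_test (reg 11) (reg 5)) word_step.

Lemma updE (T : Type) (f : nat -> T) a v b : upd f a v b = if b == a then v else f b.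
Proof. by []. Qed.

(** * Correctness of the evaluation of a word *)

Section Spec.
Variables (R : realType) (n' m : nat) (W : 'M[R[i]]_n'.+1).
Local Notation n := (n'.+1).
Implicit Types (s : state R) (U : {set 'I_n}).

Definition glob s : Prop :=
  [/\ ints s 0 = n, ints s 1 = m, ints s 2 = (n * n)%N, ints s 3 = (n * n).+1
    & forall e, (e < n * n)%N -> nums s e.+1 = W (edge_fst n' e) (edge_snd n' e)].

(** What a command leaves unchanged when it only writes integer cells from t on
    and the first u working number cells. *)
Definition frame (t u : nat) s s' : Prop :=
  (forall r, (r < t)%N -> ints s' r = ints s r) /\
  (forall a, (a < (n * n).+1)%N || ((n * n).+1 + u <= a)%N -> nums s' a = nums s a).

Lemma frame_refl t u s : frame t u s s.
Proof. by []. Qed.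

Lemma frame_trans t u s1 s2 s3 : frame t u s1 s2 -> frame t u s2 s3 -> frame t u s1 s3.
Proof. by move=> [a b] [a' b']; split=> r h; rewrite ?a' ?a ?b' ?b. Qed.

Lemma frame_weaken t u t' u' s s' : (t' <= t)%N -> (u <= u')%N ->
  frame t u s s' -> frame t' u' s s'.
Proof. by move=> h h' [a b]; split=> r hr; [apply: a|apply: b]; lia. Qed.

Lemma glob_frame t u s s' : (4 <= t)%N -> frame t u s s' -> glob s -> glob s'.
Proof.
move=> t4 [a b] [g0 g1 g2 g3 g4]; split; rewrite ?a //; try lia.
by move=> e en; rewrite b ?g4 // ltnS en.
Qed.

Definition marked s U : Prop :=
  ints s 10 = #|U| /\ forall a : 'I_n, ints s (marks + a)%N = (a \in U).

Lemma outside x u k : (x < (n * n).+1)%N || ((n * n).+1 + u <= x)%N -> (k < u)%N ->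
  (x == (n * n).+1 + k)%N = false.
Proof. by move=> h ku; apply/negbTE; move: h; lia. Qed.

Lemma divmod_spec s (q r d : nat) : (0 < ints s d)%N -> q != r -> q != d -> r != d ->
  run (divmod q r d) s (ints s r * 20 + 10) (fun s' =>
    [/\ ints s' q = (ints s r %/ ints s d)%N, ints s' r = (ints s r %% ints s d)%N,
        forall k, k != q -> k != r -> ints s' k = ints s k & nums s' = nums s]).
Proof.
move=> d0 qr qd rd; set y := ints s r; set b := ints s d.
pose I j s' := [/\ ints s' q = j, ints s' r = (y - j * b)%N,
        forall k, k != q -> k != r -> ints s' k = ints s k & nums s' = nums s].
rewrite /divmod; apply: (run_le (T := cost (iset q (ILit 0)) + (y %/ b * 19 + 6))); last first.
  apply: run_straight_seq => //=.
  apply: (run_post (Q := I (y %/ b)%N)).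
    by move=> s' [h1 h2 h3 h4]; split; rewrite ?h1 ?h2 // {1}(divn_eq y b) addKn.
  apply: (run_while (T := cost (iset r (ISub (reg r) (reg d)) ;; incr q)) (I := I)).
  - split=> //=; rewrite ?updE ?eqxx //.
      by rewrite (eq_sym r q) (negbTE qr) mul0n subn0.
    by move=> k /negbTE kq _; rewrite updE kq.
  - move=> j s' jy [h1 h2 h3 h4]; split.
      rewrite /= h2 h3 // 1?eq_sym // -/b.
      have : (j.+1 * b <= y)%N by rewrite -leq_divRL.
      by rewrite mulSn; lia.
    apply: run_straight => //=; split=> /=; rewrite ?updE.
    + by rewrite eqxx (negbTE qr) h1 addn1.
    + by rewrite (eq_sym r q) (negbTE qr) eqxx h2 h3 1?eq_sym // -/b mulSn; lia.
    + by move=> k kq kr; rewrite !updE (negbTE kq) (negbTE kr) h3.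
    + by [].
  - move=> s' [h1 h2 h3 h4]; rewrite /= h2 h3 1?eq_sym // -/b -ltnNge.
    by rewrite {1}(divn_eq y b) addKn ltn_pmod.
rewrite /=; have := leq_div y b; lia.
Qed.

Lemma clear_marks_spec s : ints s 0 = n ->
  run clear_marks s (n * 30 + 20) (fun s' =>
    frame 14 0 s s' /\ forall a : 'I_n, ints s' (marks + a)%N = 0%N).
Proof.
move=> s0.
pose I j s' := [/\ ints s' 14 = j, forall r, (r < 14)%N -> ints s' r = ints s r,
  forall a, (a < j)%N -> ints s' (marks + a)%N = 0%N & nums s' = nums s].
rewrite /clear_marks.
apply: (run_le (T := cost (iset 14 (ILit 0)) + (n * 20 + 8))); first by rewrite /=; lia.
apply: run_straight_seq => //=.
apply: (run_post (Q := I n)).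
  by move=> s' [h1 h2 h3 h4]; split=> [|a]; [split=> *; rewrite ?h2 ?h4 | exact: h3].
apply: (run_while (T := cost (ISet (mark (reg 14)) (ILit 0) ;; incr 14)) (I := I)).
- by split=> //= r hr; rewrite updE ltn_eqF.
- move=> j s' jn [h1 h2 h3 h4]; split; first by rewrite /= h1 h2 // s0 addn1.
  apply: run_straight => //=; split=> /=; rewrite ?updE /= ?h1 //.
  + by rewrite ?h1 ?addn1.
  + move=> r hr; rewrite !updE ltn_eqF // [(r == _)%N](_ : _ = false) ?h2 //.
    by rewrite /marks; lia.
  + move=> a; rewrite ltnS leq_eqVlt !updE => /orP[/eqP ->|aj].
      by rewrite eqxx.
    by rewrite /= eqn_add2l (ltn_eqF aj) h3.
- by move=> s' [h1 h2 _ _]; rewrite /= h1 h2 // s0 addn1 ltnn.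
Qed.

Lemma touch_spec s u (a : 'I_n) U : (14 <= u < marks)%N ->
  ints s 0 = n -> ints s 1 = m -> ints s 3 = (n * n).+1 ->
  marked s U -> ints s u = a ->
  run (touch u) s 80 (fun s' =>
    [/\ marked s' (a |: U),
        forall r, (r < marks)%N -> r != 10 -> ints s' r = ints s r,
        nums s' ((n * n).+1 + 2)%N = nums s ((n * n).+1 + 2)%N * touch_weight R m U a
      & forall x, (x < (n * n).+1)%N || ((n * n).+1 + 3 <= x)%N -> nums s' x = nums s x]).
Proof.
move=> /andP[u14 um] s0 s1 s3 [s10 sU] su; rewrite /touch.
apply: (run_le (T := (tcost (TLeI (IMem (mark (reg u))) (ILit 0)) + 60).+1)) => //.
apply: run_if; rewrite /= su sU /touch_weight; case: ifP => aU; last first.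
  have {}aU : a \in U by move: aU; case: (a \in U).
  apply: (run_le (T := 0)) => //; apply: run_straight => //=; rewrite aU mulr1.
  by split=> //; rewrite (setUidPr _) // sub1set.
have {}aU : (a \in U) = false by move: aU; case: (a \in U).
have Un : (#|U| < n)%N.
  by have := max_card (a |: U); rewrite cardsU1 aU card_ord add1n.
have u10 : (u == 10)%N = false by lia.
rewrite aU; set c := (X in run X).
apply: (run_le (T := cost c)) => //; apply: run_straight => //.
  rewrite /= !updE s3 !eqn_add2l /= s0 s10; split=> //; split=> //; split=> //.
  by rewrite pnatr_eq0 -lt0n subn_gt0.
split=> /=.
- split=> [|b].
    by rewrite cardsU1 aU !updE u10 su s10 /= addn1 add1n.
  rewrite !inE /= !updE u10 /= su eqn_add2l -val_eqE /=; case: (_ == _) => //=.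
- move=> r rm r10; rewrite !updE u10 su (negbTE r10) [(r == _)%N](_ : _ = false) //.
  by apply/eqP => h; move: rm; rewrite h; lia.
- by rewrite !updE s3 !eqn_add2l /= s0 s1 s10.
- by move=> x hx; rewrite !updE s3 !(outside hx).
Qed.

Lemma edge_bounds e : (e < n * n)%N ->
  [/\ edge_fst n' e = (e %/ n)%N :> nat & edge_snd n' e = (e %% n)%N :> nat].
Proof.
by move=> h; split; rewrite inordK ?ltn_mod // ltn_divLR.
Qed.

Lemma word_step_spec s U y p : glob s -> marked s U -> ints s 8 = y -> ints s 9 = p ->
  let e := (y %% (n * n))%N in
  run word_step s (y * 40 + 400) (fun s' =>
    [/\ frame 8 3 s s', marked s' (touch2 U (edge_fst n' e) (edge_snd n' e)),
        [/\ ints s' 8 = (y %/ (n * n))%N, ints s' 9 = e.+1 & ints s' 11 = (ints s 11).+1]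
      & nums s' ((n * n).+1 + 2)%N = nums s ((n * n).+1 + 2)%N * step_weight m W p U e]).
Proof.
move=> [g0 g1 g2 g3 gW] [s10 sU] s8 s9 e.
have B0 : (0 < n * n)%N by rewrite muln_gt0.
have eB : (e < n * n)%N by rewrite ltn_mod.
have ey : (e <= y)%N by exact: leq_mod.
have [aE bE] := edge_bounds eB.
apply: run_le; last first.
  apply: run_straight_seq => //=.
  set s1 := set_int _ _ _.
  have d1 : ints s1 2 = (n * n)%N by [].
  have y1 : ints s1 13 = y by [].
  apply: (run_bind (T1 := y * 20 + 10)).
    apply: (run_le (T := ints s1 13 * 20 + 10)); first by rewrite y1.
    by apply: (@divmod_spec s1 12 13 2) => //; rewrite d1.
  move=> s2 [q2 r2 k2 n2]; rewrite d1 y1 -/e in q2 r2.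
  apply: run_straight_seq => //=.
  set s3 := set_int _ _ _.
  have k3 r : r != 8 -> r != 12 -> r != 13 -> r != 15 -> ints s3 r = ints s r.
    move=> h8 h12 h13 h15; rewrite /s3 /= !updE (negbTE h15) (negbTE h8) k2 //.
    by rewrite /s1 /= updE (negbTE h13).
  have n3 : nums s3 = nums s by rewrite /s3 /= n2.
  have i3 : [/\ ints s3 8 = (y %/ (n * n))%N, ints s3 13 = e & ints s3 15 = e].
    by rewrite /s3 /= !updE /= q2 r2.
  have d3 : ints s3 0 = n by rewrite k3.
  case: i3 => i38 i313 i315.
  apply: (run_bind (T1 := y * 20 + 10)).
    apply: (run_le (T := ints s3 15 * 20 + 10)); first by rewrite i315 leq_add2r leq_mul2r ey orbT.
    by apply: (@divmod_spec s3 14 15 0) => //; rewrite d3.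
  move=> s4 [q4 r4 k4 n4]; rewrite d3 i315 -aE -bE in q4 r4.
  have k4' r : r != 8 -> r != 12 -> r != 13 -> r != 14 -> r != 15 -> ints s4 r = ints s r.
    by move=> *; rewrite k4 // k3.
  have i48 : ints s4 8 = (y %/ (n * n))%N by rewrite k4.
  have i413 : ints s4 13 = e by rewrite k4.
  pose v := if (p <= e)%N && (edge_fst n' e < edge_snd n' e)%N
            then W (edge_fst n' e) (edge_snd n' e) - 1 else 0.
  apply: (run_bind (Q1 := fun s5 => [/\ ints s5 = ints s4,
     nums s5 ((n * n).+1 + 2)%N = nums s ((n * n).+1 + 2)%N * v
     & forall x, (x < (n * n).+1)%N || ((n * n).+1 + 3 <= x)%N -> nums s5 x = nums s x])).
    apply: (@run_if _ _ _ _ _ 40); rewrite /= q4 r4 i413 (k4' 9) // s9 addn1 /v.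
    case: ifP => hc.
      apply: (run_le (T := cost _)); last apply: run_straight => //; first by [].
      split=> //=.
        have eO : (e.+1 < (n * n).+1)%N || ((n * n).+1 + 3 <= e.+1)%N by rewrite ltnS eB.
        by rewrite !updE (k4' 3) // g3 !eqn_add2l /= n4 n3 i413 addn1 !(outside eO) // gW // hc.
      by move=> x hx; rewrite !updE (k4' 3) // g3 n4 n3 !(outside hx).
    apply: (run_le (T := cost _)); last apply: run_straight => //; first by [].
    split=> //=.
      by rewrite !updE (k4' 3) // g3 eqxx hc mulr0.
    by move=> x hx; rewrite !updE (k4' 3) // g3 n4 n3 (outside hx).
  move=> s5 [k5 p5 n5].
  have m5 : marked s5 U.
    by split=> [|a]; rewrite k5 k4'.
  apply: run_bind.
    apply: (@touch_spec s5 14 (edge_fst n' e) U) => //; rewrite k5;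
      by [rewrite k4' | rewrite q4].
  move=> s6 [m6 k6 p6 n6].
  apply: run_bind.
    apply: (@touch_spec s6 15 (edge_snd n' e) (edge_fst n' e |: U)) => //;
      rewrite k6 // k5; by [rewrite k4' | rewrite r4].
  move=> s7 [m7 k7 p7 n7].
  have k7' r : (r < marks)%N -> r != 8 -> r != 10 -> r != 12 -> r != 13 -> r != 14 -> r != 15 ->
      ints s7 r = ints s r.
    by move=> *; rewrite k7 // k6 // k5 k4'.
  apply: run_straight => //; split.
  - split=> [r hr|x hx] /=.
      have h k : (8 <= k)%N -> (r == k) = false by move=> k8; apply: ltn_eqF; exact: leq_trans k8.
      by rewrite !updE !h // k7' ?h // (leq_trans hr).
    by rewrite n7 // n6 // n5.
  - by case: m7 => h1 h2; split=> /=.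
  - by split=> /=; rewrite ?updE /= ?k7 // ?k6 // ?k5 ?i48 ?i413 ?addn1 ?k4'.
  - by rewrite /= p7 p6 p5 /step_weight -/v; ring.
rewrite /=; lia.
Qed.

(** The invariant keeps the product of the weights read so far times the
    weight of the word_weight that remains. *)
Lemma word_prog_spec s l x : glob s -> ints s 5 = l -> ints s 7 = x ->
  run word_prog s (n * 30 + l * (x * 40 + 450) + 100) (fun s' =>
    frame 8 3 s s' /\ nums s' ((n * n).+1 + 2)%N = word_weight m W l x 0 set0).
Proof.
move=> gs s5 s7; rewrite /word_prog.
apply: run_le; last first.
  apply: run_bind; first by apply: clear_marks_spec; case: gs.
  move=> s1 [f1 z1]; have g1 : glob s1 by apply: glob_frame gs; last exact: f1.
  have [g10 g11 g12 g13 g14] := g1.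
  apply: run_straight_seq => //=.
  set s2 := set_num _ _ _.
  have f2 : frame 8 3 s1 s2.
    split=> [r hr|a ha]; rewrite /s2 /= ?updE.
      have h k : (8 <= k)%N -> (r == k) = false by move=> k8; apply: ltn_eqF; exact: leq_trans k8.
      by rewrite !h.
    by rewrite g13 (outside ha).
  have m2 : marked s2 set0.
    by split=> [|a]; rewrite /s2 /= !updE /= ?cards0 // z1 inE.
  have f12 : frame 8 3 s s2 by apply: frame_trans f2; apply: frame_weaken f1.
  have g2 : glob s2 by apply: glob_frame f12 gs.
  have p2 : nums s2 ((n * n).+1 + 2)%N = 1 by rewrite /s2 /= !updE /= g13 eqxx.
  pose I j s' := frame 8 3 s2 s' /\ exists y p U, [/\ marked s' U, ints s' 8 = y /\ ints s' 9 = p,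
     ints s' 11 = j, (y <= x)%N
     & nums s' ((n * n).+1 + 2)%N * word_weight m W (l - j) y p U = word_weight m W l x 0 set0].
  apply: (run_post (Q := I l)).
    move=> s' [f' [y [p [U [_ _ _ _]]]]]; rewrite subnn mulr1 => ->.
    by split=> //; exact: frame_trans f12 f'.
  apply: (run_while (T := x * 40 + 400) (I := I)).
  - split; first exact: frame_refl.
    exists x, 0%N, set0; split=> //; last by rewrite p2 subn0 mul1r.
    split=> //; rewrite /s2 /= ?updE //=.
    by case: f1 => -> // _; rewrite s7.
  - move=> j s' jl [f' [y [p [U [m' [h8 h9] h11 yx hw]]]]].
    have g' : glob s' by apply: glob_frame f' g2.
    split; first by rewrite /= h11 (proj1 f') // (proj1 f12) // s5 addn1.
    apply: (run_le (T := y * 40 + 400)); first by lia.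
    apply: run_post (word_step_spec g' m' h8 h9) => s'' [f'' m'' [k8 k9 k11] pp].
    split; first exact: frame_trans f' f''.
    exists (y %/ (n * n))%N, (y %% (n * n)).+1,
       (touch2 U (edge_fst n' (y %% (n * n))) (edge_snd n' (y %% (n * n)))).
    split=> //; first by rewrite k11 h11.
      by apply: leq_trans yx; exact: leq_div.
    rewrite pp -hw -mulrA; congr (_ * _).
    by rewrite -[(l - j)%N]prednK ?subn_gt0 // -subnS.
  - move=> s' [f' [y [p [U [_ _ h11 _ _]]]]].
    by rewrite /= h11 (proj1 f') // (proj1 f12) // s5 addn1 ltnn.
rewrite /=; lia.
Qed.

End Spec.

(** * The phases of the program *)

Definition word_loop : cmd :=
  While (lt_test (reg 7) (reg 6))
    (word_prog ;; (NOp ArAdd (num 3) (num 3) (num 2) ;; incr 7)).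

Definition coef_prog : cmd :=
  (iset 5 (ILit 0) ;; iset 6 (ILit 1)) ;;
  While (TLeI (reg 5) (reg 4))
    ((NCast (num 3) (ILit 0) ;; iset 7 (ILit 0)) ;;
     word_loop ;;
     (NCopy (coef_cell (reg 5)) (num 3) ;; iset 6 (IMul (reg 6) (reg 2)) ;; incr 5)).

Definition root_loop : cmd :=
  While (TLeI (reg 6) (reg 5))
    (NCast (num 0) (reg 6) ;;
     NCast (num 1) (IMul (reg 1) (reg 1)) ;;
     NOp ArDiv (num 0) (num 0) (num 1) ;;
     NCast (num 1) (ISub (reg 5) (reg 6)) ;;
     NOp ArSub (num 0) (num 0) (num 1) ;;
     NOp ArMul (num 0) (num 0) (coef_cell (reg 6)) ;;
     NOp ArMul (num 0) (num 0) (root_cell (ISub (reg 5) (reg 6))) ;;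
     NOp ArAdd (num 3) (num 3) (num 0) ;;
     incr 6).

Definition root_prog : cmd :=
  (NCast (root_cell (ILit 0)) (ILit 1) ;; NCast (num 4) (ILit 1) ;; iset 5 (ILit 1)) ;;
  While (TLeI (reg 5) (reg 4))
    ((NCast (num 3) (ILit 0) ;; iset 6 (ILit 1)) ;;
     root_loop ;;
     (NCast (num 0) (reg 5) ;;
      NOp ArDiv (num 3) (num 3) (num 0) ;;
      NCopy (root_cell (reg 5)) (num 3) ;;
      NOp ArAdd (num 4) (num 4) (num 3) ;;
      incr 5)).

Definition out_prog : cmd :=
  (NCast (num 5) (ILit 1) ;; iset 5 (ILit 0)) ;;
  While (lt_test (reg 5) (IMul (reg 1) (reg 1)))
    (NOp ArMul (num 5) (num 5) (num 4) ;; incr 5) ;;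
  iset 5 (ILit 0) ;;
  While (lt_test (reg 5) (reg 1))
    (NCast (num 0) (ISub (reg 0) (reg 5)) ;;
     NCast (num 1) (IAdd (reg 5) (ILit 1)) ;;
     NOp ArMul (num 5) (num 5) (num 0) ;;
     NOp ArDiv (num 5) (num 5) (num 1) ;;
     incr 5) ;;
  NCopy (ILit 0) (num 5).

(** The degree is the least k with 1440 m ^ 2 (9/10) ^ k <= eps. *)
Definition degree_prog : cmd :=
  (iset 2 (IMul (reg 0) (reg 0)) ;; iset 3 (IAdd (reg 2) (ILit 1)) ;;
   NCast (num 0) (ILit 9) ;; NCast (num 1) (ILit 10) ;; NOp ArDiv (num 0) (num 0) (num 1) ;;
   NCast (num 1) (IMul (ILit 1440) (IMul (reg 1) (reg 1)))) ;;
  While (TNot (TLeN (num 1) (ILit 0)))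
    (NOp ArMul (num 1) (num 1) (num 0) ;; incr 4).

Definition clique_prog : cmd := degree_prog ;; coef_prog ;; root_prog ;; out_prog.

(** * Correctness of the phases *)

Section ProgramSpec.
Variables (R : realType) (n' m : nat) (W : 'M[R[i]]_n'.+1).
Local Notation n := (n'.+1).
Local Notation base := (n * n).+1.
Implicit Types (s : state R).
Local Notation glob := (@glob R n' m W).
Local Notation frame := (@frame R n').

Definition clique_coef l : R[i] := word_sum m W l 0 set0.
Definition clique_root_coef j : R[i] := root_coef clique_coef (m * m) j.

Lemma word_loop_spec s l X : glob s -> ints s 5 = l -> ints s 6 = X -> ints s 7 = 0%N ->
  nums s (base + 3)%N = 0 ->
  run word_loop s (X * (n * 30 + l * (X * 40 + 450) + 150) + 20) (fun s' =>
    frame 7 4 s s' /\ nums s' (base + 3)%N = \sum_(0 <= x < X) word_weight m W l x 0 set0).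
Proof.
move=> gs s5 s6 s7 s3.
pose I j s' := [/\ frame 7 4 s s', ints s' 7 = j
  & nums s' (base + 3)%N = \sum_(0 <= x < j) word_weight m W l x 0 set0].
apply: (run_le (T := X * (7 + (n * 30 + l * (X * 40 + 450) + 100 + 20)).+1 + 8)).
  by apply: leq_add => //; rewrite leq_mul2l; apply/orP; right; lia.
apply: (run_post (Q := I X)); first by move=> s' [f' _ h].
apply: (run_while (T := n * 30 + l * (X * 40 + 450) + 100 + 20) (I := I)).
- by split=> //; rewrite big_geq.
- move=> j s' jX [f' h7 h3]; split.
    by rewrite /= h7 (proj1 f') // s6 addn1.
  have g' : glob s' by apply: glob_frame gs; last exact: f'.
  have h5 : ints s' 5 = l by rewrite (proj1 f').
  apply: (run_bind (T1 := n * 30 + l * (X * 40 + 450) + 100)).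
    apply: run_le (word_prog_spec g' h5 h7).
    by rewrite leq_add2r leq_add2l leq_mul2l leq_add2r leq_mul2r (ltnW jX) !orbT.
  move=> s1 [f1 h1].
  have g1 : glob s1 by apply: glob_frame g'; last exact: f1.
  have [_ _ _ b1 _] := g1.
  apply: (run_le (T := cost (NOp ArAdd (num 3) (num 3) (num 2) ;; incr 7))) => //.
  apply: run_straight => //; split.
  + apply: frame_trans f' _; split=> [r hr|x hx] /=.
      by rewrite updE ltn_eqF // (proj1 f1) // ltnW.
    rewrite updE b1 (outside hx) // (proj2 f1) //.
    by case/orP: hx => h; rewrite ?h //; apply/orP; right; lia.
  + by rewrite /= updE /= (proj1 f1) // h7 addn1.
  + rewrite /= updE b1 eqxx h1 (proj2 f1) ?h3 ?big_nat_recr //=.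
    by rewrite leqnn orbT.
- by move=> s' [f' h7 _]; rewrite /= h7 (proj1 f') // s6 addn1 ltnn.
Qed.

Lemma coef_prog_spec s k : glob s -> ints s 4 = k ->
  let Y := ((n * n) ^ k)%N in
  run coef_prog s (k.+1 * (Y * (n * 30 + k * (Y * 40 + 450) + 150) + 100) + 50) (fun s' =>
    [/\ glob s', ints s' 4 = k
     & forall i, (i <= k)%N -> nums s' (base + (10 + 2 * i))%N = clique_coef i]).
Proof.
move=> gs s4 Y; rewrite /coef_prog.
pose T := (10 + ((Y * (n * 30 + k * (Y * 40 + 450) + 150) + 20) + 50))%N.
apply: (run_le (T := 10 + (k.+1 * (5 + T).+1 + 6))).
  rewrite /T; set Z := (Y * _)%N.
  rewrite [leqRHS](_ : _ = 34 + (k.+1 * (Z + 100) + 16))%N; last by lia.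
  by apply: leq_add => //; apply: leq_add => //; rewrite leq_mul2l; apply/orP; right; lia.
pose I j s' := [/\ glob s', ints s' 4 = k, ints s' 5 = j, ints s' 6 = ((n * n) ^ j)%N
     & forall i, (i < j)%N -> nums s' (base + (10 + 2 * i))%N = clique_coef i].
apply: (run_bind (T1 := 10) (Q1 := I 0%N)).
  apply: (run_le (T := cost (iset 5 (ILit 0) ;; iset 6 (ILit 1)))) => //.
  apply: run_straight => //; split => //=.
move=> s1 I1; apply: (run_post (Q := I k.+1)).
  by move=> s' [g' h4 _ _ h]; split.
apply: (run_while (T := T) (I := I)) => //.
  move=> j s' jk [g' h4 h5 h6 h]; split; first by rewrite /= h4 h5.
  have [_ _ h2 h3 _] := g'.
  pose J s2 := [/\ frame 7 4 s' s2, ints s2 7 = 0%N & nums s2 (base + 3)%N = 0].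
  rewrite /T; apply: (run_bind (T1 := 10) (Q1 := J)).
    apply: (run_le (T := cost (NCast (num 3) (ILit 0) ;; iset 7 (ILit 0)))) => //.
    apply: run_straight => //; split=> /=.
    + split=> [r hr|x hx] /=; first by rewrite updE ltn_eqF.
      by rewrite updE h3 (outside hx).
    + by rewrite updE.
    + by rewrite updE h3 eqxx.
  move=> s2 [f2 h27 h23].
  have g2 : glob s2 by apply: glob_frame g'; last exact: f2.
  have h25 : ints s2 5 = j by rewrite (proj1 f2).
  have h26 : ints s2 6 = ((n * n) ^ j)%N by rewrite (proj1 f2).
  have jY : ((n * n) ^ j <= Y)%N by rewrite leq_pexp2l // muln_gt0.
  apply: (run_bind (T1 := Y * (n * 30 + k * (Y * 40 + 450) + 150) + 20)).
    apply: run_le (word_loop_spec g2 h25 h26 h27 h23).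
    rewrite leq_add2r; apply: leq_mul => //; rewrite leq_add2r leq_add2l.
    by apply: leq_mul => //; rewrite leq_add2r leq_mul2r jY orbT.
  move=> s3 [f3 h33].
  have f23 : frame 7 4 s' s3 by exact: frame_trans f2 f3.
  have g3 : glob s3 by apply: glob_frame g'; last exact: f23.
  have [g30 g31 g32 g33 g3W] := g3.
  have k3 r : (r < 7)%N -> ints s3 r = ints s' r by exact: (proj1 f23).
  set c := (X in run X); apply: (run_le (T := cost c)) => //.
  apply: run_straight => //; split=> /=.
  + split=> //= e he; rewrite updE g3W // g33 (_ : (e.+1 == _) = false) //.
    by apply: ltn_eqF; rewrite addSn ltnS; apply: leq_trans he _; exact: leq_addr.
  + by rewrite !updE ?k3 // h4.
  + by rewrite !updE /= k3 // h5 addn1.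
  + by rewrite !updE /= k3 // h6 g32 expnSr.
  + move=> i; rewrite ltnS leq_eqVlt !updE g33 k3 // h5 !eqn_add2l /= => /orP[/eqP ->|ij].
      by rewrite eqxx h33.
    rewrite eqn_mul2l (ltn_eqF ij) /= (proj2 f23) ?h //.
    by apply/orP; right; rewrite leq_add2l.
by move=> s' [_ h4 h5 _ _]; rewrite /= h4 h5 ltnn.
Qed.

Lemma root_loop_spec s j : ints s 1 = m -> (0 < m)%N -> ints s 3 = base ->
  ints s 5 = j.+1 -> ints s 6 = 1%N -> nums s (base + 3)%N = 0 ->
  (forall i, (i <= j.+1)%N -> nums s (base + (10 + 2 * i))%N = clique_coef i) ->
  (forall i, (i <= j)%N -> nums s (base + (11 + 2 * i))%N = clique_root_coef i) ->
  run root_loop s (j.+1 * 150 + 20) (fun s' =>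
    frame 6 4 s s' /\ nums s' (base + 3)%N =
      \sum_(i < j.+1) (i.+1%:R / (m * m)%:R - (j.+1 - i.+1)%:R) * clique_coef i.+1 * clique_root_coef (j.+1 - i.+1)).
Proof.
move=> s1 m0 s3 s5 s6 s03 hc hr.
pose I t s' := [/\ frame 6 4 s s', ints s' 6 = t.+1 & nums s' (base + 3)%N =
  \sum_(i < t) (i.+1%:R / (m * m)%:R - (j.+1 - i.+1)%:R) * clique_coef i.+1 * clique_root_coef (j.+1 - i.+1)].
apply: (run_post (Q := I j.+1)); first by move=> s' [f' _ h].
rewrite /root_loop; set c := (X in While _ X).
apply: (run_le (T := j.+1 * (5 + cost c).+1 + 6)); first by rewrite /=; lia.
apply: (run_while (T := cost c) (I := I)).
- by split=> //; rewrite big_ord0.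
- move=> t s' tj [f' h6 h3].
  have k' r : (r < 6)%N -> ints s' r = ints s r by exact: (proj1 f').
  have far x : (4 <= x)%N -> nums s' (base + x)%N = nums s (base + x)%N.
    by move=> hx; rewrite (proj2 f') // leq_add2l hx orbT.
  split; first by rewrite /= h6 k' // s5.
  have mm0 : (m * m)%:R != 0 :> R[i] by rewrite pnatr_eq0 -lt0n muln_gt0 m0.
  have jt : (j.+1 - t.+1 <= j)%N by rewrite subSS leq_subr.
  apply: run_straight => //.
    rewrite /= !updE !(k' 3) // s3 !eqn_add2l /= !(k' 1) // s1.
    by do !split.
  split=> /=.
  + apply: frame_trans f' _; split=> [r hr'|x hx] /=.
      by rewrite updE ltn_eqF.
    by rewrite !updE !(k' 3) // s3 !(outside hx).
  + by rewrite !updE /= h6 addn1.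
  + rewrite !updE !(k' 3) // s3 !eqn_add2l /= !(k' 1) // !(k' 5) // s1 s5 h6 h3.
    by rewrite !far // hc // hr // big_ord_recr.
- by move=> s' [f' h6 _]; rewrite /= h6 (proj1 f') // s5 ltnn.
Qed.

Lemma root_prog_spec s k : glob s -> (0 < m)%N -> ints s 4 = k ->
  (forall i, (i <= k)%N -> nums s (base + (10 + 2 * i))%N = clique_coef i) ->
  run root_prog s (k * (k * 150 + 200) + 60) (fun s' =>
    [/\ ints s' 0 = n, ints s' 1 = m, ints s' 3 = base
      & nums s' (base + 4)%N = \sum_(j < k.+1) clique_root_coef j]).
Proof.
move=> [s0 s1 _ s3 _] m0 s4 hc.
pose T := (10 + ((k * 150 + 20) + 60))%N.
pose I j s' := [/\ forall r, (r < 5)%N -> ints s' r = ints s r, ints s' 5 = j.+1,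
  forall i, (i <= k)%N -> nums s' (base + (10 + 2 * i))%N = clique_coef i,
  forall i, (i <= j)%N -> nums s' (base + (11 + 2 * i))%N = clique_root_coef i
  & nums s' (base + 4)%N = \sum_(t < j.+1) clique_root_coef t].
rewrite /root_prog; set c0 := (X in Seq X _).
have odd_even i i' : (11 + 2 * i == 10 + 2 * i')%N = false by lia.
have even_odd i i' : (10 + 2 * i == 11 + 2 * i')%N = false by lia.
apply: (run_le (T := cost c0 + (k * (5 + T).+1 + 6))); first by rewrite /= /T; lia.
apply: run_straight_seq => //.
apply: (run_post (Q := I k)).
  by move=> s' [h _ _ _ ->]; rewrite !h // s0 s1 s3.
apply: (run_while (T := T) (I := I)).
- split=> /=.
  + by move=> r hr; rewrite updE ltn_eqF.
  + by [].
  + move=> i ik; by rewrite !updE s3 !(eqn_add2l base) even_odd /= hc.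
  + move=> i; rewrite leqn0 => /eqP ->.
    by rewrite !updE s3 !(eqn_add2l base) /= /clique_root_coef root_coef0.
  + by rewrite !updE s3 !eqn_add2l /= big_ord1 /clique_root_coef root_coef0.
- move=> j s' jk [hlow h5 hc' hr hs]; split; first by rewrite /= h5 hlow // s4.
  have h1 : ints s' 1 = m by rewrite hlow.
  have h3 : ints s' 3 = base by rewrite hlow.
  rewrite /T.
  pose J s2 := [/\ frame 6 4 s' s2, ints s2 6 = 1%N & nums s2 (base + 3)%N = 0].
  apply: (run_bind (T1 := 10) (Q1 := J)).
    apply: (run_le (T := cost (NCast (num 3) (ILit 0) ;; iset 6 (ILit 1)))) => //.
    apply: run_straight => //; split=> /=.
    + split=> [r hr'|x hx] /=; first by rewrite updE ltn_eqF.
      by rewrite updE h3 (outside hx).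
    + by rewrite updE.
    + by rewrite updE h3 eqxx.
  move=> s2 [f2 h26 h23].
  have far2 x : (4 <= x)%N -> nums s2 (base + x)%N = nums s' (base + x)%N.
    by move=> hx; rewrite (proj2 f2) // leq_add2l hx orbT.
  apply: (run_bind (T1 := k * 150 + 20)).
    apply: (run_le (T := j.+1 * 150 + 20)); first by rewrite leq_add2r leq_mul2r jk orbT.
    apply: root_loop_spec => //; try by rewrite (proj1 f2).
    + by move=> i ij; rewrite far2 // hc' //; exact: leq_trans ij jk.
    + by move=> i ij; rewrite far2 // hr.
  move=> s5 [f5 h53].
  have k5 r : (r < 6)%N -> ints s5 r = ints s' r.
    by move=> hr'; rewrite (proj1 f5) ?(proj1 f2).
  have far5 x : (4 <= x)%N -> nums s5 (base + x)%N = nums s' (base + x)%N.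
    by move=> hx; rewrite (proj2 f5) ?far2 // leq_add2l hx orbT.
  have j0 : j.+1%:R != 0 :> R[i] by rewrite pnatr_eq0.
  have rE : nums s5 (base + 3)%N / j.+1%:R = clique_root_coef j.+1.
    by rewrite h53 /clique_root_coef root_coefS.
  set c := (X in run X); apply: (run_le (T := cost c)) => //.
  apply: run_straight => //.
    rewrite /= !updE !(k5 3) // h3 eqxx !(k5 5) // h5.
    by do !split.
  split=> /=.
  + by move=> r hr'; rewrite updE ltn_eqF // k5 ?hlow // ltnW.
  + by rewrite !updE /= (k5 5) // h5 addn1.
  + by move=> i ik; rewrite !updE !(k5 3) // h3 !(eqn_add2l base) even_odd /= far5 ?hc'.
  + move=> i; rewrite leq_eqVlt !updE !(k5 3) // !(k5 5) // h3 h5 !eqn_add2l /=.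
    move=> /orP[/eqP ->|ij]; first by rewrite eqxx rE.
    by rewrite eqn_mul2l (ltn_eqF ij) /= far5 // hr.
  + rewrite !updE !(k5 3) // !(k5 5) // h3 h5 !(eqn_add2l base) /= ?eqxx rE.
    by rewrite far5 // hs [RHS]big_ord_recr.
- by move=> s' [hlow h5 _ _ _]; rewrite /= h5 hlow // s4 ltnn.
Qed.

(** The binomial coefficient is the product of the (n - i) / (i + 1). *)
Lemma out_prog_spec s z : (m <= n)%N -> ints s 0 = n -> ints s 1 = m -> ints s 3 = base ->
  nums s (base + 4)%N = z ->
  run out_prog s (m * m * 50 + m * 80 + 60) (fun s' =>
    output s' = 'C(n, m)%:R * z ^+ (m * m)).
Proof.
move=> mn s0 s1 s3 s4; rewrite /out_prog.
set c0 := (X in Seq X _); set c1 := (X in Seq (While _ X) _).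
set c2 := (X in Seq (While _ X) (NCopy _ _)).
pose K s' := [/\ ints s' 0 = n, ints s' 1 = m & ints s' 3 = base].
apply: (run_le (T := cost c0 + ((m * m * (10 + cost c1).+1 + 11) +
   (3 + ((m * (7 + cost c2).+1 + 8) + 6))))); first by rewrite /=; lia.
apply: run_straight_seq => //.
pose I1 j s' := [/\ K s', ints s' 5 = j, nums s' (base + 4)%N = z & nums s' (base + 5)%N = z ^+ j].
apply: (run_bind (Q1 := I1 (m * m)%N)).
  apply: (run_while (T := cost c1) (I := I1)).
  - by split=> /=; rewrite ?updE ?s3 ?eqn_add2l //= ?eqxx.
  - move=> j s' jm [[h0 h1 h3] h5 h4 hz]; split; first by rewrite /= h5 h1 addn1.
    apply: run_straight => //; split=> //=; rewrite ?updE /= ?h5 ?addn1 //.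
    + by rewrite h3 !eqn_add2l.
    + by rewrite h3 eqxx hz h4 exprSr.
  - by move=> s' [[h0 h1 h3] h5 _ _]; rewrite /= h5 h1 addn1 ltnn.
move=> sa [[a0 a1 a3] _ _ az].
apply: (run_bind (Q1 := fun s' => [/\ K s', ints s' 5 = 0%N & nums s' (base + 5)%N = z ^+ (m * m)])).
  by apply: (run_le (T := cost (iset 5 (ILit 0)))) => //; apply: run_straight.
move=> sb [Kb b5 bz].
pose I2 j s' := [/\ K s', ints s' 5 = j & nums s' (base + 5)%N = 'C(n, j)%:R * z ^+ (m * m)].
apply: (run_bind (Q1 := I2 m)).
  apply: (run_while (T := cost c2) (I := I2)).
  - by split=> //; rewrite bin0 mul1r.
  - move=> j s' jm [[h0 h1 h3] h5 hz]; split; first by rewrite /= h5 h1 addn1.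
    have j0 : j.+1%:R != 0 :> R[i] by rewrite pnatr_eq0.
    apply: run_straight => //.
      rewrite /= !updE h3 !eqn_add2l /= h5 addn1.
      by do !split.
    split=> /=; [by split | by rewrite updE h5 addn1 | ].
    rewrite !updE h3 !(eqn_add2l base) /= h0 h5 hz [(j + 1)%N]addn1; apply: (mulIf j0).
    rewrite divfK // mulrAC -natrM mulrAC -natrM; congr (_%:R * _).
    by rewrite mulnC -mul_bin_left mulnC.
  - by move=> s' [[h0 h1 h3] h5 _]; rewrite /= h5 h1 addn1 ltnn.
move=> sc [[k0 k1 k3] _ cz].
apply: (run_le (T := cost (NCopy (ILit 0) (num 5)))) => //; apply: run_straight => //.
by rewrite /output /= updE k3.
Qed.

Definition threshold (j : nat) : R := 1440 * (m * m)%:R * (9 / 10) ^+ j.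

Lemma degree_prog_spec (eps : R) k : (threshold k <= eps) ->
  (forall j, (j < k)%N -> eps < threshold j) ->
  run degree_prog (input m eps W) (k * 50 + 100) (fun s' => glob s' /\ ints s' 4 = k).
Proof.
move=> hk hlt; rewrite /degree_prog; set c0 := (X in Seq X _); set c1 := (X in While _ X).
apply: (run_le (T := cost c0 + (k * (7 + cost c1).+1 + 8))); first by rewrite /=; lia.
pose I j s' := [/\ glob s', ints s' 4 = j, nums s' 0 = eps%:C,
   nums s' (base + 0)%N = 9 / 10 & nums s' (base + 1)%N = (threshold j)%:C].
have low e x : (e < base)%N -> (e == base + x)%N = false.
  by move=> h; apply: ltn_eqF; apply: leq_trans h _; exact: leq_addr.
have ten : 10%:R != 0 :> R[i] by rewrite pnatr_eq0.
apply: run_straight_seq => //.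
  by rewrite /= !updE /= !(addn1 (n * n)) !(eqn_add2l base); do !split.
apply: (run_post (Q := I k)); first by move=> s' [].
apply: (run_while (T := cost c1) (I := I)).
- split.
  + split=> //=; first by rewrite addn1.
    move=> e he; rewrite !updE /= !(addn1 (n * n)) !low //.
    have [h1 h2] : (e %/ n < n)%N /\ (e %% n < n)%N by rewrite ltn_mod ltn_divLR.
    rewrite !insubT; congr (W _ _); apply: val_inj; rewrite /= inordK //.
  + by [].
  + by rewrite /= !updE /= ?(addn1 (n * n)) ?low.
  + by rewrite /= !updE /= !(addn1 (n * n)) !(eqn_add2l base).
  + rewrite /= !updE /= !(addn1 (n * n)) eqxx /threshold expr0 mulr1 -natrM.
    by rewrite rmorph_nat.
- move=> j s' jk [g' h4 h0 hb hb1].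
  have [_ _ _ h3 hW] := g'; split.
    by rewrite /= h3 hb1 h0 lecR -ltNge hlt.
  apply: run_straight => //; split=> //=.
  + have [g0 g1 g2 _ _] := g'; split=> //= e he.
    by rewrite updE h3 low // hW.
  + by rewrite updE h4 addn1.
  + by rewrite updE h3 low.
  + by rewrite updE h3 eqn_add2l.
  + rewrite updE h3 eqxx hb1 hb /threshold exprSr mulrA [in RHS]rmorphM.
    by congr (_ * _); rewrite rmorphM fmorphV !rmorph_nat.
- by move=> s' [[_ _ _ h3 _] _ h0 _ hb1]; rewrite /= h3 hb1 h0 lecR negbK.
Qed.

End ProgramSpec.

(** * Time bound and conclusion *)

(** Every quantity is at most Z = n ^ (2 k + 1), and the sum is of degree 4. *)
Lemma time_bound n m k Y : Y = ((n * n) ^ k)%N -> (1 < n)%N -> (m <= n)%N ->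
  ((k * 50 + 100) + ((k.+1 * (Y * (n * 30 + k * (Y * 40 + 450) + 150) + 100) + 50)
    + ((k * (k * 150 + 200) + 60) + (m * m * 50 + m * 80 + 60)))
   <= n ^ (8 * k + 16))%N.
Proof.
move=> YE n1 mn.
pose Z := (n ^ (2 * k + 1))%N.
have n0 : (0 < n)%N by exact: ltnW.
have YZ : (Y <= Z)%N by rewrite YE /Z mulnn -expnM leq_pexp2l // leq_addr.
have nZ : (n <= Z)%N by rewrite -{1}[n]expn1 leq_pexp2l // leq_addl.
have mZ : (m <= Z)%N by exact: leq_trans nZ.
have kZ : (k.+1 <= Z)%N.
  apply: leq_trans (ltn_expl k n1) _; rewrite leq_pexp2l //; lia.
have Z0 : (0 < Z)%N by rewrite expn_gt0 n0.
have -> : (n ^ (8 * k + 16) = Z ^ 4 * n ^ 12)%N.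
  by rewrite -expnM -expnD; congr (_ ^ _)%N; lia.
have n12 : (4096 <= n ^ 12)%N by apply: (@leq_trans (2 ^ 12)); last rewrite leq_exp2r.
apply: (@leq_trans (Z ^ 4 * 4096)); last by rewrite leq_mul2l n12 orbT.
have k1 : (k <= Z)%N by exact: ltnW.
move: YE => _.
have e1 : (k * (Y * 40 + 450) <= Z * Z * 490)%N.
  apply: (@leq_trans (Z * (Z * 40 + Z * 450))); last by lia.
  apply: leq_mul => //; apply: leq_add; first by rewrite leq_mul2r YZ orbT.
  by rewrite leq_pmull.
have Z2 : (Z <= Z * Z)%N by rewrite leq_pmulr.
have e2 : (Y * (n * 30 + k * (Y * 40 + 450) + 150) <= Z * (Z * Z * 670))%N.
  by apply: leq_mul => //; lia.
have Z3 : (Z * Z <= Z * (Z * Z))%N by rewrite leq_pmull.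
have Z4 : (Z * (Z * Z) <= Z * (Z * (Z * Z)))%N by rewrite leq_pmull.
have e3 : (k.+1 * (Y * (n * 30 + k * (Y * 40 + 450) + 150) + 100)
   <= Z * (Z * (Z * Z) * 770))%N.
  by apply: leq_mul => //; lia.
have e4 : (k * (k * 150 + 200) <= Z * (Z * 350))%N by apply: leq_mul => //; lia.
have e5 : (m * m <= Z * Z)%N by exact: leq_mul.
have -> : (Z ^ 4 = Z * (Z * (Z * Z)))%N by rewrite !expnS expn0 muln1.
move: e1 e2 e3 e4 e5 Z2 Z3 Z4.
rewrite (_ : Z * (Z * (Z * Z) * 770) = Z * (Z * (Z * Z)) * 770)%N; last by lia.
rewrite (_ : Z * (Z * 350) = Z * Z * 350)%N; last by lia.
move: (_ * (_ + 100))%N (k * (k * _ + _))%N (m * m)%N (Z * (Z * (Z * Z)))%N (Z * (Z * Z))%N (Z * Z)%N.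
move=> A B C D F G _ _ *; lia.
Qed.

Lemma clique_prog_spec (R : realType) (n' m : nat) (eps : R) (W : 'M[R[i]]_n'.+1) (k : nat) :
  (1 < m <= n'.+1)%N -> threshold R m k <= eps ->
  (forall j, (j < k)%N -> eps < threshold R m j) ->
  run clique_prog (input m eps W) (n'.+1 ^ (8 * k + 16)) (fun s =>
    output s = 'C(n'.+1, m)%:R * (\sum_(j < k.+1) clique_root_coef m W j) ^+ (m * m)).
Proof.
move=> /andP[m1 mn] hk hlt.
apply: run_le (time_bound (erefl ((n'.+1 * n'.+1) ^ k)%N) (leq_trans m1 mn) mn) _.
apply: run_bind (degree_prog_spec W hk hlt) _ => s1 [g1 h4].
apply: run_bind (coef_prog_spec g1 h4) _ => s2 [g2 h24 hc].
apply: run_bind (root_prog_spec g2 (ltnW m1) h24 hc) _ => s3 [h0 h1 h3 hz].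
exact: out_prog_spec.
Qed.

Section Degree.
Variable R : realType.

Lemma threshold_exists m (eps : R) : 0 < eps -> exists j, threshold R m j <= eps.
Proof.
move=> e0; pose x : R := 9 * (1440 * (m * m)%:R) / eps.
have x0 : 0 <= x by rewrite divr_ge0 ?mulr_ge0 // ltW.
exists (Num.bound x); set j := Num.bound x.
have := archi_boundP x0; rewrite -/j /x ltr_pdivrMr // => hj.
have := @bernoulli R (1 / 9) j; rewrite (_ : 1 + 1 / 9 = (9 / 10)^-1); last by field.
rewrite exprVn /threshold => /(_ ltac:(lra)) hb.
have p0 : 0 < (9 / 10) ^+ j :> R by rewrite exprn_gt0 //; lra.
have {}hb : (1 + j%:R * (1 / 9)) * (9 / 10) ^+ j <= 1 :> R.
  by have := ler_wpM2r (ltW p0) hb; rewrite mulVf ?gt_eqF.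
have : (j%:R * eps) * (9 / 10) ^+ j <= 9 * eps.
  have : eps * ((1 + j%:R * (1 / 9)) * (9 / 10) ^+ j) <= eps * 1 by rewrite ler_wpM2l // ltW.
  have : 0 <= eps * (9 / 10) ^+ j by rewrite mulr_ge0 // ltW.
  lra.
have : 9 * (1440 * (m * m)%:R) * (9 / 10) ^+ j <= j%:R * eps * (9 / 10) ^+ j.
  by rewrite ler_wpM2r ?ltW.
lra.
Qed.

Lemma ln2_ge : 1 / 2 <= ln 2 :> R.
Proof.
have := @le_ln1Dx R (- (1 / 2)) ltac:(lra).
rewrite (_ : 1 + - (1 / 2) = 2^-1); last by field.
rewrite lnV ?posrE //; lra.
Qed.

(** By minimality of k, eps < 1440 m ^ 2 (9/10) ^ (k-1); here 1440 <= m ^ 11 and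
    ln (9/10) <= - 1/10. *)
Lemma degree_le m (eps : R) k : (1 < m)%N -> 0 < eps < 1 ->
  (forall j, (j < k)%N -> eps < threshold R m j) ->
  k%:R <= 1 + 130 * (ln m%:R - ln eps) :> R.
Proof.
move=> m1 /andP[e0 e1] hlt.
have m0 : 0 < m%:R :> R by rewrite ltr0n ltnW.
have lm : ln 2 <= ln m%:R :> R by rewrite ler_ln ?posrE // ler_nat.
have le : ln eps <= 0 by rewrite ln_le0 // ltW.
have l2 := ln2_ge.
case: k hlt => [|k] hlt; first by lra.
have := hlt k (ltnSn k); rewrite /threshold => h.
have p0 : 0 < (9 / 10) ^+ k :> R by rewrite exprn_gt0 //; lra.
have lh : ln eps < ln (1440 * (m * m)%:R * (9 / 10) ^+ k).
  by rewrite ltr_ln ?posrE //; apply: lt_trans h.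
move: lh; rewrite natrM lnM ?posrE ?mulr_gt0 // lnM ?posrE ?mulr_gt0 // lnM ?posrE //.
rewrite lnXn; last by lra.
have l1440 : ln 1440 <= 11 * ln m%:R :> R.
  rewrite mulr_natl -lnXn // ler_ln ?posrE ?exprn_gt0 //.
  apply: (@le_trans _ _ (2 ^+ 11)); last by rewrite lerXn2r ?nnegrE // ?ler_nat // ltW.
  by rewrite -natrX ler_nat.
have l9 : ln (9 / 10) <= - (1 / 10) :> R.
  have := @le_ln1Dx R (- (1 / 10)) ltac:(lra).
  by rewrite (_ : 1 + - (1 / 10) = 9 / 10) //; field.
have : ln (9 / 10) *+ k <= - (1 / 10) * k%:R :> R.
  by rewrite -[_ *+ k]mulr_natr ler_wpM2r.
rewrite -natr1; lra.
Qed.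

End Degree.

(** The exponent 8 k + 16 is at most 1040 (ln m - ln eps) + 24, and
    ln m - ln eps >= ln 2 >= 1/2 absorbs the constant. *)
Lemma clique_prog_approximates (R : realType) (gamma : R) n m :
  (1 < m <= n)%N -> 0 <= gamma ->
  let d := 10 / 9 * (gamma / (m%:R - 1)) in
  d < 1 -> 2 * d * (m%:R - 1) <= 9 / 22 * (1 - d) ->
  approximates_cliques clique_prog gamma 1088 n m.
Proof.
case: n => [|n'] mn; first by case/andP: mn => h; rewrite leqn0 => /eqP e; rewrite e in h.
move=> g0 d d1 hd eps W e01 sW nW.
have /andP[m1 mn'] := mn; have /andP[e0 e1] := e01.
have m0 : 0 < m%:R - 1 :> R by rewrite subr_gt0 ltr1n.
have [k hk kmin] := ex_minnP (threshold_exists m e0).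
have hlt j : (j < k)%N -> eps < threshold R m j.
  by move=> jk; rewrite ltNge; apply/negP => /kmin; rewrite leqNgt jk.
have [t [s [ex tT out]]] := clique_prog_spec W mn hk hlt.
exists t, s; split=> //.
- rewrite !norm_cabs -rmorphM lecR out.
  apply: (clique_root_approx (d := gamma / (m%:R - 1))) => //.
  + by rewrite ltnW.
  + by rewrite divr_ge0 // ltW.
  + by move=> i j; rewrite -lecR -norm_cabs.
- have n1 : 1 <= n'.+1%:R :> R by rewrite ler1n.
  apply: (@le_trans _ _ ((n'.+1 ^ (8 * k + 16))%N%:R)); first by rewrite ler_nat.
  rewrite natrX -powR_mulrn //; apply: ler_powR => //.
  have hk2 := degree_le m1 e01 hlt.
  have l2 := ln2_ge R.
  have lm : ln 2 <= ln m%:R :> R by rewrite ler_ln ?posrE ?ltr0n ?ler_nat // ltnW.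
  have le : ln eps <= 0 by rewrite ln_le0 // ltW.
  rewrite natrD natrM; lra.
Qed.

Theorem mainTheorem2 (R : realType) :
  (exists gamma : R, 0 < gamma /\
     exists (prog : cmd) (C : R),
       forall n m : nat, (1 < m <= n)%N ->
         approximates_cliques prog gamma C n m)
  /\
  (exists (prog : cmd) (C : R),
     forall n m : nat, (1 < m <= n)%N ->
       approximates_cliques prog (6%:R / 100%:R) C n m)
  /\
  (exists (prog : cmd) (C : R),
     forall n m : nat, (1 < m <= n)%N -> (4 * m <= n)%N -> (10 <= m)%N ->
       approximates_cliques prog (18%:R / 100%:R) C n m).
Proof.
(* L is a lower bound of m - 1; for gamma = .18 and L = 9, the last hypothesis is
   an equality. *)
have small (gamma : R) (L : nat) n m : (1 < m <= n)%N -> (L < m)%N -> 0 < L%:R :> R ->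
    0 <= gamma -> 10 / 9 * gamma < L%:R :> R ->
    2 * (10 / 9 * gamma) <= 9 / 22 * (1 - 10 / 9 * (gamma / L%:R)) ->
    approximates_cliques clique_prog gamma 1088 n m.
  move=> mn Lm L0 g0 gL hg.
  have Lm' : L%:R <= m%:R - 1 :> R by rewrite lerBrDr natr1 ler_nat.
  have m0 : 0 < m%:R - 1 :> R by exact: lt_le_trans L0 Lm'.
  have gm : gamma / (m%:R - 1) <= gamma / L%:R by rewrite ler_wpM2l // lef_pV2.
  have gL1 : 10 / 9 * (gamma / L%:R) < 1 by rewrite mulrA ltr_pdivrMr // mul1r.
  apply: clique_prog_approximates => //; first by lra.
  rewrite (_ : 2 * _ * _ = 2 * (10 / 9 * gamma)); first by lra.
  by field; rewrite gt_eqF.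
have h6 n m : (1 < m <= n)%N -> approximates_cliques clique_prog (6 / 100 : R) 1088 n m.
  move=> mn; have /andP[m1 _] := mn; apply: (small _ 1%N) => //; lra.
split; first by exists (6 / 100); split; [lra | exists clique_prog, 1088].
split; first by exists clique_prog, 1088.
exists clique_prog, 1088 => n m mn _ m10.
by apply: (small _ 9%N) => //; lra.
Qed.
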